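(* Let $(X_0,X_1)$ be a compatible couple and let $a\in SV(0,\infty)\cap AC(0,\infty)$ satisfy $$a\ \text{is strictly decreasing},\quad a(0)=\infty,\quad a(\infty)>0.$$ Let $\alpha\in SV(0,\infty)\cap AC(0,\infty)$ be such that $$\alpha\ \text{is strictly decreasing},\quad \alpha(0)=\infty,\quad \alpha(\infty)=0,$$ assume that $A\in SV(0,\infty)$ is given by $$A(x):=a(x)\ \text{ if } x\in(0,1],\qquad A(x):=c\,\alpha(x)\ \text{ if } x\in(1,\infty),$$ where $c$ is a positive constant chosen in such a way that $A\in AC(0,\infty)$, and let $$B(x):=-x\,A'(x)\quad\text{for a.a. } x>0.$$ Then $$(X_0,X_1)_{0,1,a;J}=(X_0,X_1)_{0,1,a;J;(0,1)},$$ $$(X_0,X_0\cap X_1)_{0,1,A;J}=(X_0,X_0\cap X_1)_{0,1,A;J;(0,1)},$$ $$(X_0,X_0\cap X_1)_{0,1,B;K}=(X_0,X_0\cap X_1)_{0,1,B;K;(0,1)}.$$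
   Context: A pair $(Y_0,Y_1)$ of Banach spaces is a compatible couple if there is a Hausdorff topological vector space in which both are continuously embedded. $Y_0\cap Y_1$ carries the norm $\max\{\|f\|_{Y_0},\|f\|_{Y_1}\}$ and $Y_0+Y_1$ the norm $\inf\{\|f_0\|_{Y_0}+\|f_1\|_{Y_1}: f=f_0+f_1\}$. For $t>0$, $$K(f,t;Y_0,Y_1):=\inf\{\|f_0\|_{Y_0}+t\|f_1\|_{Y_1}: f=f_0+f_1,\ f_0\in Y_0,\ f_1\in Y_1\}\quad (f\in Y_0+Y_1),$$ $$J(f,t;Y_0,Y_1):=\max\{\|f\|_{Y_0},t\|f\|_{Y_1}\}\quad (f\in Y_0\cap Y_1).$$ $\|\cdot\|_{1,(c,d)}$ is the $L_1$-norm on $(c,d)$. For an interval $I=(0,\infty)$ or $I=(0,1)$ and a weight $v$ (non-negative, measurable, finite a.e.) define: - the $K$-space on $I$: all $f\in Y_0+Y_1$ with $\|t^{-1}v(t)K(f,t;Y_0,Y_1)\|_{1,I}<\infty$, this expression being the norm; - the $J$-space on $I$: all $f\in Y_0+Y_1$ for which there is a strongly measurable $u:I\to Y_0\cap Y_1$ with $f=\int_I u(s)\,\frac{ds}{s}$ (convergence in $Y_0+Y_1$) and for which $\inf\|t^{-1}v(t)J(u(t),t;Y_0,Y_1)\|_{1,I}$ is finite, the infimum (which is the norm of $f$) being over all such representations of $f$. For $I=(0,\infty)$ these are denoted $(Y_0,Y_1)_{0,1,v;K}$ and $(Y_0,Y_1)_{0,1,v;J}$; for $I=(0,1)$ they are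 denoted $(Y_0,Y_1)_{0,1,v;K;(0,1)}$ and $(Y_0,Y_1)_{0,1,v;J;(0,1)}$. Equality of two spaces means that they are equal as sets and their norms are equivalent. $SV(0,\infty)$ is the set of slowly varying functions: positive, finite, Lebesgue-measurable functions $b$ on $(0,\infty)$ such that for each $\varepsilon>0$, $t^{\varepsilon}b(t)$ is equivalent to a non-decreasing function on $(0,\infty)$ and $t^{-\varepsilon}b(t)$ is equivalent to a non-increasing function on $(0,\infty)$ (two non-negative functions are equivalent if each is bounded by a positive constant multiple of the other). $AC(0,\infty)$ is the set of functions that are absolutely continuous on every compact subinterval of $(0,\infty)$. For monotone $f$ on $(0,\infty)$, $f(0):=\lim_{t\to0+}f(t)$ and $f(\infty):=\lim_{t\to\infty}f(t)$. *)

(* Defs.v *)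
From HB Require Import structures.
From mathcomp Require Import all_boot all_order all_algebra.
From mathcomp Require Import all_classical all_reals all_analysis.
From mathcomp Require Import measurable_realfun.

Set Implicit Arguments.
Unset Strict Implicit.
Unset Printing Implicit Defensive.

Import Order.TTheory GRing.Theory Num.Theory.
Import numFieldNormedType.Exports.

Local Open Scope classical_set_scope.
Local Open Scope ring_scope.

(** * Functions on (0, +oo), given as functions on R whose values on
    (-oo, 0] are irrelevant *)

Section functions.
Context {R : realType}.
Implicit Types f g b : R -> R.

Definition equiv_fun f g : Prop :=
  (exists2 c : R, 0 < c & forall t : R, 0 < t -> f t <= c * g t) /\
  (exists2 c : R, 0 < c & forall t : R, 0 < t -> g t <= c * f t).

Definition equiv_nondecreasing f : Prop :=
  exists g, [/\ forall t : R, 0 < t -> 0 <= g t,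
    forall s t : R, 0 < s -> s <= t -> g s <= g t & equiv_fun f g].

Definition equiv_nonincreasing f : Prop :=
  exists g, [/\ forall t : R, 0 < t -> 0 <= g t,
    forall s t : R, 0 < s -> s <= t -> g t <= g s & equiv_fun f g].

(** [measurable] on [R] means Borel; [completed_algebra_gen] yields the
    Lebesgue-measurable sets. *)
Definition lebesgue_measurable_fun (D : set R) f : Prop :=
  forall V : set R, measurable V ->
    completed_algebra_gen (@lebesgue_measure R) (D `&` f @^-1` V).

Definition slowly_varying b : Prop :=
  [/\ forall t : R, 0 < t -> 0 < b t,
      lebesgue_measurable_fun `]0, +oo[%classic b &
      forall e : R, 0 < e ->
        equiv_nondecreasing (fun t => t `^ e * b t) /\
        equiv_nonincreasing (fun t => t `^ (- e) * b t)].

Definition abs_continuous_on (s t : R) f : Prop :=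
  forall e : R, 0 < e -> exists2 d : R, 0 < d &
    forall (n : nat) (l r : 'I_n -> R),
      (forall i, s <= l i /\ l i <= r i /\ r i <= t) ->
      trivIset [set: 'I_n] (fun i => `]l i, r i[%classic) ->
      \sum_(i < n) (r i - l i) < d ->
      \sum_(i < n) `|f (r i) - f (l i)| < e.

Definition loc_abs_continuous f : Prop :=
  forall s t : R, 0 < s -> s <= t -> abs_continuous_on s t f.

Definition strictly_decreasing f : Prop :=
  forall s t : R, 0 < s -> s < t -> f t < f s.

Definition norm1 (I : set R) (g : R -> R) : \bar R :=
  (\int[@lebesgue_measure R]_(t in I) (`|g t|)%:E)%E.

End functions.

(** * Normed subspaces of a topological vector space *)

(** [nrm Y] is only meaningful on [car Y].  The normed-space axioms are not
    part of the structure, so that sums, intersections and interpolation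
    spaces can be formed before any of them is proved. *)
Record nspace (R : realType) (E : Type) := NSpace {
  car : set E ;
  nrm : E -> R }.

Definition eq_nspace (R : realType) (E : Type) (Y Z : nspace R E) : Prop :=
  car Y = car Z /\
  exists c C : R, [/\ 0 < c, 0 < C & forall f, car Y f ->
    c * nrm Y f <= nrm Z f /\ nrm Z f <= C * nrm Y f].

Section couples.
Context {R : realType} {E : topologicalLmodType R}.
Implicit Types (X : normedModType R) (Y : nspace R E) (I : set R) (f : E).

Definition continuous_embedding X (i : {linear X -> E}) : Prop :=
  injective i /\ continuous i.

(** The copy of [X] inside [E], with the norm transported along the
    injection [i]. *)
Definition embedded X (i : {linear X -> E}) : nspace R E :=
  NSpace (range i) (fun f => `|xget 0 [set x | i x = f]|).

Definition decompositions Y0 Y1 f : set (E * E) :=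
  [set p | [/\ car Y0 p.1, car Y1 p.2 & f = p.1 + p.2]].

Definition capY Y0 Y1 : nspace R E :=
  NSpace (car Y0 `&` car Y1) (fun f => Num.max (nrm Y0 f) (nrm Y1 f)).

Definition sumY Y0 Y1 : nspace R E :=
  NSpace [set f | decompositions Y0 Y1 f !=set0]
    (fun f => inf [set nrm Y0 p.1 + nrm Y1 p.2 | p in decompositions Y0 Y1 f]).

Definition Kfun Y0 Y1 f (t : R) : R :=
  inf [set nrm Y0 p.1 + t * nrm Y1 p.2 | p in decompositions Y0 Y1 f].

Definition Jfun Y0 Y1 f (t : R) : R := Num.max (nrm Y0 f) (t * nrm Y1 f).

(** * Vector-valued integration over a subset [I] of the line, with respect to
    Lebesgue measure *)

(** Borel level sets suffice in simple functions: limits are only required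
    almost everywhere, so this gives the Lebesgue strongly measurable
    functions. *)
Definition simple_on I Y (s : R -> E) : Prop :=
  (forall t, I t -> car Y (s t)) /\
  (forall y, measurable (I `&` s @^-1` [set y])).

Definition strongly_measurable I Y (u : R -> E) : Prop :=
  (forall t, I t -> car Y (u t)) /\
  exists s : nat -> {fimfun R >-> E}, (forall n, simple_on I Y (s n)) /\
    {ae @lebesgue_measure R, forall t, I t ->
      (fun n : nat => nrm Y (u t - s n t)) @ \oo --> (0 : R)}.

Definition integrable_simple I Y (s : R -> E) : Prop :=
  simple_on I Y s /\
  forall y, y != 0 -> (@lebesgue_measure R (I `&` s @^-1` [set y]) < +oo)%E.

Definition simple_integral I (s : R -> E) : E :=
  \sum_(y \in range s) fine (@lebesgue_measure R (I `&` s @^-1` [set y])) *: y.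

(** [f] is the Bochner integral of [g] over [I], in the space [Y].  The
    library's [\int] of a non-negative function is the supremum of the
    integrals of the Borel simple functions below it, hence the usual integral
    for every Lebesgue-measurable non-negative integrand. *)
Definition is_bochner_integral I Y (g : R -> E) f : Prop :=
  strongly_measurable I Y g /\
  exists s : nat -> {fimfun R >-> E},
    [/\ forall n, integrable_simple I Y (s n),
        (\int[@lebesgue_measure R]_(t in I) (nrm Y (g t - s n t))%:E)%E
          @[n --> \oo] --> 0%E &
        (fun n : nat => nrm Y (f - simple_integral I (s n))) @ \oo --> (0 : R)].

(** * The K- and J-spaces on [I] with parameters (0, 1, v) *)

Definition Knorm Y0 Y1 I (v : R -> R) f : \bar R :=
  norm1 I (fun t => t^-1 * v t * Kfun Y0 Y1 f t).

Definition Kspace Y0 Y1 I (v : R -> R) : nspace R E :=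
  NSpace [set f | car (sumY Y0 Y1) f /\ (Knorm Y0 Y1 I v f < +oo)%E]
    (fun f => fine (Knorm Y0 Y1 I v f)).

Definition Jrepresentation Y0 Y1 I f (u : R -> E) : Prop :=
  strongly_measurable I (capY Y0 Y1) u /\
  is_bochner_integral I (sumY Y0 Y1) (fun s => s^-1 *: u s) f.

Definition Jnorm Y0 Y1 I (v : R -> R) f : \bar R :=
  ereal_inf [set norm1 I (fun t => t^-1 * v t * Jfun Y0 Y1 (u t) t)
    | u in Jrepresentation Y0 Y1 I f].

(** [Jnorm Y0 Y1 I v f] is [+oo] when [f] has no representation. *)
Definition Jspace Y0 Y1 I (v : R -> R) : nspace R E :=
  NSpace [set f | car (sumY Y0 Y1) f /\ (Jnorm Y0 Y1 I v f < +oo)%E]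
    (fun f => fine (Jnorm Y0 Y1 I v f)).

End couples.

(* Main.v *)
Require Import Defs.
From HB Require Import structures.
From mathcomp Require Import all_boot all_order all_algebra.
From mathcomp Require Import all_classical all_reals all_analysis.
From mathcomp Require Import finmap measurable_realfun.

From mathcomp Require Import ring lra.

Set Implicit Arguments.
Unset Strict Implicit.
Unset Printing Implicit Defensive.

Import Order.TTheory GRing.Theory Num.Theory.
Import numFieldNormedType.Exports.

Local Open Scope classical_set_scope.
Local Open Scope ring_scope.

(** The three identities say that the part of the parameter interval beyond 1
    carries no more information than one vector of the smaller space or one
    value of a norm.

    For the J-spaces (Jspace_truncate), a representation u on (0,1) is extended
    by zero.  Conversely, let f be the integral of u(s) ds/s over (0,oo).  For
    t >= 1 the weight satisfies kappa |u(t)| <= v(t) J(u(t),t), where |.| is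
    the norm of the intersection: for v = a because a >= a(oo) > 0, and for
    v = A on the couple (X0, X0 `&` X1) because J(x,t) >= t |x| and t A(t) is
    bounded below on [1,oo) by slow variation.  Hence the tail of the integral
    over [1,oo) converges absolutely in the intersection, which is a Banach
    space, to a vector g whose norm is at most the cost of u divided by kappa.
    Adding to u a bump on (1/2,1) with integral g restores f from (0,1), and
    since J(x,t) <= |x| for t <= 1 and v is bounded on (1/2,1), the bump costs
    at most a multiple of |g|.  Both identities are instances, as
    X0 `&` (X0 `&` X1) = X0 `&` X1.

    For the K-spaces (Kspace_truncate), the sum of X0 and X0 `&` X1 is X0, with
    K(f,t) <= |f|_0 for all t and K(f,t) >= t |f|_0 for t <= 1.  Since
    B(t)/t = - A'(t) almost everywhere, the norm over [1,oo) is at most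
    |f|_0 times the integral of - A', hence at most A(1) |f|_0, while the norm
    over (0,1) is at least half of (A(1/2) - A(1)) |f|_0, which is a positive
    multiple of |f|_0 because A is strictly decreasing on (0,1].  Both
    estimates use that the decreasing function A recovers its increments from
    its derivative (decreasing_density); here absolute continuity makes the
    Stieltjes measure of - A absolutely continuous with respect to Lebesgue
    measure, so that it has a Radon-Nikodym density, which is - A' by
    Lebesgue's differentiation theorem. *)

(** * Integrals of non-negative functions without measurability *)

Section lower_integral.
Context d (T : measurableType d) (R : realType).
Variable mu : {measure set T -> \bar R}.
Implicit Types (D : set T) (f g : T -> \bar R).
Local Open Scope ereal_scope.

Import HBNNSimple.

Lemma lower_integral_mono D1 D2 f g : D1 `<=` D2 ->
  (forall x, D1 x -> 0 <= f x) -> (forall x, D2 x -> 0 <= g x) ->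
  (forall x, D1 x -> f x <= g x) ->
  \int[mu]_(x in D1) f x <= \int[mu]_(x in D2) g x.
Proof.
move=> D12 f0 g0 fg; rewrite !ge0_integralE//.
apply: ge_ereal_sup => _ [h/= hf <-]; apply: ereal_sup_ubound.
exists h => // x /=; apply: (le_trans (hf x)).
rewrite /patch; case: ifPn => [/set_mem D1x|_].
  by rewrite mem_set ?fg//; exact: D12.
by case: ifPn => // /set_mem /g0.
Qed.

(** The integral of a non-negative function is the supremum of the integrals
    of the simple functions below it.  Weights and norms of strongly measurable
    functions are Borel at best up to a null set, and the K-functional enters
    with no measurability at all, so estimates are reduced to Borel minorants. *)
Lemma lower_integral_le D f M : measurable D ->
  (forall x, D x -> 0 <= f x) ->
  (forall h : T -> R, measurable_fun setT h -> (forall x, (0 <= h x)%R) ->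
    (forall x, D x -> (h x)%:E <= f x) ->
    \int[mu]_(x in D) (h x)%:E <= M) ->
  \int[mu]_(x in D) f x <= M.
Proof.
move=> mD f0 hM; rewrite ge0_integralE//.
apply: ge_ereal_sup => _ [h/= hf <-].
have hD : h \_ D = h.
  apply/funext => x; rewrite /patch; case: ifPn => // xD.
  have := hf x; rewrite /patch (negbTE xD) lee_fin => hx0.
  by apply/eqP; rewrite eq_le hx0 fun_ge0.
rewrite -{1}hD -integral_nnsfun//; apply: hM => //.
- by move=> x Dx; have := hf x; rewrite /patch mem_set.
Qed.

(** Null sets can be dropped because this is so for every Borel minorant; in
    this way almost everywhere hypotheses become pointwise ones. *)
Lemma lower_integral_setD_null D Z f : measurable D -> measurable Z ->
  mu Z = 0 -> (forall x, D x -> 0 <= f x) ->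
  \int[mu]_(x in D) f x = \int[mu]_(x in D `\` Z) f x.
Proof.
move=> mD mZ Z0 f0; apply/eqP; rewrite eq_le; apply/andP; split.
  apply: lower_integral_le => // h mh h0 hf.
  rewrite (ge0_negligible_integral mZ mD _ _ Z0); first last.
  - by move=> x _; rewrite lee_fin.
  - by apply/measurable_EFinP; exact: measurable_funTS.
  apply: lower_integral_mono => //.
  - by move=> x _; rewrite lee_fin.
  - by move=> x [Dx _]; exact: f0.
  - by move=> x [Dx _]; exact: hf.
apply: lower_integral_mono => //.
by move=> x [Dx _]; exact: f0.
Qed.

Lemma lower_integral_setU D1 D2 f : measurable D1 -> measurable D2 ->
  [disjoint D1 & D2] -> (forall x, (D1 `|` D2) x -> 0 <= f x) ->
  \int[mu]_(x in D1 `|` D2) f x <=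
  \int[mu]_(x in D1) f x + \int[mu]_(x in D2) f x.
Proof.
move=> mD1 mD2 D12 f0; apply: lower_integral_le => //.
  exact: measurableU.
move=> h mh h0 hf; rewrite ge0_integral_setU//; first last.
- by move=> x _; rewrite lee_fin.
- by apply/measurable_EFinP; exact: measurable_funTS.
by apply: leeD; apply: lower_integral_mono => // x Dx; rewrite ?lee_fin//;
  (apply: f0 || apply: hf); by [left|right].
Qed.

(** If g is measurable, a minorant h of f + g yields the minorant max(0, h - g)
    of f.  Two non-measurable summands would not do. *)
Lemma lower_integralD D f (g : T -> R) : measurable D ->
  (forall x, D x -> 0 <= f x) -> (forall x, D x -> (0 <= g x)%R) ->
  measurable_fun D g ->
  \int[mu]_(x in D) (f x + (g x)%:E) <=
  \int[mu]_(x in D) f x + \int[mu]_(x in D) (g x)%:E.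
Proof.
move=> mD f0 g0 mg; apply: lower_integral_le => //.
  by move=> x Dx; rewrite adde_ge0 ?f0// lee_fin g0.
move=> h mh h0 hfg.
pose k x := Num.max 0%R (h x - g x)%R.
have mk : measurable_fun D k.
  apply: measurable_maxr; first exact: measurable_cst.
  by apply: measurable_funB => //; exact: measurable_funTS.
have k0 x : (0 <= k x)%R by rewrite /k le_max lexx.
apply: (@le_trans _ _ (\int[mu]_(x in D) ((k x)%:E + (g x)%:E))).
  apply: lower_integral_mono => //.
  - by move=> x _; rewrite lee_fin.
  - by move=> x Dx; rewrite adde_ge0 ?lee_fin ?g0.
  - by move=> x Dx; rewrite -EFinD lee_fin -lerBlDr /k le_max lexx orbT.
rewrite ge0_integralD//; first last.
- exact/measurable_EFinP.
- exact/measurable_EFinP.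
  by move=> x _; rewrite lee_fin.
apply: leeD => //; apply: lower_integral_mono => //.
- by move=> x _; rewrite lee_fin.
- move=> x Dx; rewrite /k EFin_max ge_max f0//=.
  by rewrite EFinB leeBlDr// hfg.
Qed.

Lemma lower_integralZl D f (k : R) : measurable D -> (0 < k)%R ->
  (forall x, D x -> 0 <= f x) ->
  \int[mu]_(x in D) (k%:E * f x) <= k%:E * \int[mu]_(x in D) f x.
Proof.
move=> mD k0 f0; apply: lower_integral_le => //.
  by move=> x Dx; rewrite mule_ge0 ?f0// lee_fin ltW.
move=> h mh h0 hf.
have -> : \int[mu]_(x in D) (h x)%:E =
    k%:E * \int[mu]_(x in D) (k^-1 * h x)%:E.
  rewrite -ge0_integralZl_EFin ?(ltW k0)//.
  - by apply: eq_integral => x _; rewrite -EFinM mulVKf// gt_eqF.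
  - by move=> x _; rewrite lee_fin mulr_ge0// invr_ge0 ltW.
  - apply/measurable_EFinP; apply: measurable_funM => //.
    exact: measurable_funTS.
rewrite lee_pmul2l//; apply: lower_integral_mono => //.
- by move=> x _; rewrite lee_fin mulr_ge0// invr_ge0 ltW.
- by move=> x Dx; rewrite EFinM lee_pdivrMl// hf.
Qed.

End lower_integral.

(** The real line and the domain of the Lebesgue measure are two measurable
    structures with the same Borel sets; sets and functions are given here in
    terms of the former. *)
Lemma lebesgue_integral_setD_null (R : realType) (D Z : set R) (f : R -> \bar R) :
  measurable D -> measurable Z -> lebesgue_measure Z = 0%E ->
  (forall x, D x -> (0 <= f x)%E) ->
  (\int[lebesgue_measure]_(x in D) f x =
   \int[lebesgue_measure]_(x in D `\` Z) f x)%E.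
Proof. exact: (@lower_integral_setD_null _ (measurableTypeR R) R lebesgue_measure). Qed.

(** * Seminormed subspaces *)

Section seminormed.
Context {R : realType} {E : topologicalLmodType R}.
Implicit Types (Y : nspace R E) (f g : E).

(** These axioms pass to sums and intersections with no condition on the
    pair, whereas definiteness of the norm of a sum depends on the ambient
    topology. *)
Record seminormed Y : Prop := Seminormed {
  car0 : car Y 0 ;
  carD : forall f g, car Y f -> car Y g -> car Y (f + g) ;
  carZ : forall (k : R) f, car Y f -> car Y (k *: f) ;
  nrm_ge0 : forall f, car Y f -> 0 <= nrm Y f ;
  nrmZ : forall (k : R) f, car Y f -> nrm Y (k *: f) = `|k| * nrm Y f ;
  nrmD : forall f g, car Y f -> car Y g -> nrm Y (f + g) <= nrm Y f + nrm Y g }.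

Definition complete_nspace Y : Prop :=
  forall f : nat -> E, (forall n, car Y (f n)) ->
    (forall e : R, 0 < e -> exists N, forall n m, (N <= n)%N -> (N <= m)%N ->
      nrm Y (f n - f m) < e) ->
    exists2 g, car Y g & (fun n : nat => nrm Y (g - f n)) @ \oo --> (0 : R).

Section consequences.
Variable Y : nspace R E.
Hypothesis Ysn : seminormed Y.

Lemma carN f : car Y f -> car Y (- f).
Proof. by move=> Yf; rewrite -scaleN1r; exact: carZ. Qed.

Lemma carB f g : car Y f -> car Y g -> car Y (f - g).
Proof. by move=> Yf Yg; apply: carD => //; exact: carN. Qed.

Lemma nrm0 : nrm Y 0 = 0.
Proof. by rewrite -(scale0r 0) nrmZ ?normr0 ?mul0r//; exact: car0. Qed.

Lemma nrmN f : car Y f -> nrm Y (- f) = nrm Y f.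
Proof. by move=> Yf; rewrite -scaleN1r nrmZ// normrN1 mul1r. Qed.

Lemma nrmB f g : car Y f -> car Y g -> nrm Y (f - g) = nrm Y (g - f).
Proof. by move=> Yf Yg; rewrite -nrmN ?opprB//; exact: carB. Qed.

Lemma nrm_sub_triangle h f g : car Y f -> car Y g -> car Y h ->
  nrm Y (f - g) <= nrm Y (f - h) + nrm Y (h - g).
Proof.
move=> Yf Yg Yh; have -> : f - g = (f - h) + (h - g) by rewrite addrA subrK.
by apply: nrmD => //; exact: carB.
Qed.

Lemma nrm_le_sub f g : car Y f -> car Y g -> nrm Y f <= nrm Y g + nrm Y (f - g).
Proof.
move=> Yf Yg; rewrite -{1}(subrK g f) addrC.
by apply: nrmD => //; exact: carB.
Qed.

Lemma nrm_dist f g : car Y f -> car Y g ->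
  `|nrm Y f - nrm Y g| <= nrm Y (f - g).
Proof.
move=> Yf Yg; rewrite ler_distl lerBlDr (nrm_le_sub Yf Yg) andbT.
by rewrite (nrmB Yf Yg) nrm_le_sub.
Qed.

End consequences.

Lemma embeddedE (X : normedModType R) (i : {linear X -> E}) (x : X) :
  injective i -> nrm (embedded i) (i x) = `|x|.
Proof.
move=> inji /=; congr (`| _ |); apply: inji.
by have := @xgetPex _ 0 [set y | i y = i x] (ex_intro _ x erefl).
Qed.

Lemma seminormed_embedded (X : normedModType R) (i : {linear X -> E}) :
  injective i -> seminormed (embedded i).
Proof.
move=> inji; split => [|_ _ [x _ <-] [y _ <-]|k _ [x _ <-]|_ [x _ <-]
  |k _ [x _ <-]|_ _ [x _ <-] [y _ <-]].
- by exists 0; rewrite ?linear0.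
- by exists (x + y); rewrite ?linearD.
- by exists (k *: x); rewrite ?linearZ.
- by rewrite embeddedE.
- by rewrite -linearZ !embeddedE// normrZ.
- by rewrite -linearD !embeddedE// ler_normD.
Qed.

Lemma seminormed_capY (Y0 Y1 : nspace R E) : seminormed Y0 -> seminormed Y1 ->
  seminormed (capY Y0 Y1).
Proof.
move=> s0 s1; split => [|f g [f0 f1] [g0 g1]|k f [f0 f1]|f [f0 f1]
  |k f [f0 f1]|f g [f0 f1] [g0 g1]].
- by split; exact: car0.
- by split; exact: carD.
- by split; exact: carZ.
- by rewrite /= le_max nrm_ge0.
- by rewrite /= !nrmZ// maxr_pMr.
- rewrite /= ge_max; apply/andP; split.
    apply: le_trans (nrmD s0 f0 g0) _.
    by apply: lerD; rewrite le_max lexx.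
  apply: le_trans (nrmD s1 f1 g1) _.
  by apply: lerD; rewrite le_max lexx orbT.
Qed.

Section sum.
Variables Y0 Y1 : nspace R E.
Hypotheses (s0 : seminormed Y0) (s1 : seminormed Y1).

Lemma decomposition_image f (t : R) : car (sumY Y0 Y1) f ->
  [set nrm Y0 p.1 + t * nrm Y1 p.2 | p in decompositions Y0 Y1 f] !=set0.
Proof. by move=> [p Yp]; exists (nrm Y0 p.1 + t * nrm Y1 p.2); exists p. Qed.

Lemma Kfun_has_lbound f (t : R) : 0 <= t ->
  has_lbound [set nrm Y0 p.1 + t * nrm Y1 p.2 | p in decompositions Y0 Y1 f].
Proof.
move=> t0; exists 0 => _ [p [p0 p1 _] <-].
by rewrite addr_ge0 ?mulr_ge0 ?nrm_ge0.
Qed.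

Lemma Kfun_le f (t : R) p : 0 <= t -> decompositions Y0 Y1 f p ->
  Kfun Y0 Y1 f t <= nrm Y0 p.1 + t * nrm Y1 p.2.
Proof. by move=> t0 Yp; apply: ge_inf; [exact: Kfun_has_lbound|exists p]. Qed.

Lemma le_Kfun f (t m : R) : car (sumY Y0 Y1) f ->
  (forall p, decompositions Y0 Y1 f p -> m <= nrm Y0 p.1 + t * nrm Y1 p.2) ->
  m <= Kfun Y0 Y1 f t.
Proof.
move=> Yf Ym; apply: lb_le_inf; first exact: decomposition_image.
by move=> _ [p Yp <-]; exact: Ym.
Qed.

Lemma Kfun_ge0 f (t : R) : 0 <= t -> car (sumY Y0 Y1) f -> 0 <= Kfun Y0 Y1 f t.
Proof.
move=> t0 Yf; apply: le_Kfun => // p [p0 p1 _].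
by rewrite addr_ge0 ?mulr_ge0 ?nrm_ge0.
Qed.

Lemma nrm_sumYE f : nrm (sumY Y0 Y1) f = Kfun Y0 Y1 f 1.
Proof.
by rewrite /= /Kfun; congr inf; apply: eq_imagel => p _; rewrite mul1r.
Qed.

(** Scaling by k <> 0 is a bijection between decompositions; equality in
    homogeneity comes from applying the inequality to k and to its inverse. *)
Lemma seminormed_sumY : seminormed (sumY Y0 Y1).
Proof.
have sumZ (k : R) f : car (sumY Y0 Y1) f -> car (sumY Y0 Y1) (k *: f).
  move=> [[f0 f1] [/= Yf0 Yf1 ->]]; exists (k *: f0, k *: f1).
  by split => /=; rewrite ?scalerDr//; exact: carZ.
have le0 : nrm (sumY Y0 Y1) 0 <= 0.
  rewrite nrm_sumYE; apply: le_trans (@Kfun_le 0 1 (0, 0) ler01 _) _.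
    by split; rewrite /= ?addr0//; exact: car0.
  by rewrite /= !nrm0// mulr0 addr0.
have leZ (k : R) f : k != 0 -> car (sumY Y0 Y1) f ->
    nrm (sumY Y0 Y1) (k *: f) <= `|k| * nrm (sumY Y0 Y1) f.
  move=> k0 Yf; rewrite !nrm_sumYE -ler_pdivrMl ?normr_gt0//.
  apply: le_Kfun => // p [p0 p1 fE]; rewrite mul1r ler_pdivrMl ?normr_gt0//.
  apply: le_trans (@Kfun_le _ 1 (k *: p.1, k *: p.2) ler01 _) _.
    by split; rewrite /= ?fE ?scalerDr//; exact: carZ.
  by rewrite /= !nrmZ// mul1r mulrDr.
split => [|f g [[f0 f1] [/= Yf0 Yf1 ->]] [[g0 g1] [/= Yg0 Yg1 ->]]|//|f Yf
  |k f Yf|f g Yf Yg].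
- by exists (0, 0); split; rewrite /= ?addr0//; exact: car0.
- by exists (f0 + g0, f1 + g1); split; rewrite /= 1?addrACA//; exact: carD.
- by rewrite nrm_sumYE Kfun_ge0.
- have [->|k0] := eqVneq k 0.
    rewrite scale0r normr0 mul0r; apply/eqP; rewrite eq_le le0 andTb.
    rewrite nrm_sumYE Kfun_ge0//.
    by exists (0, 0); split; rewrite /= ?addr0//; exact: car0.
  apply/eqP; rewrite eq_le leZ// andTb -ler_pdivlMl ?normr_gt0//.
  rewrite -normfV; apply: le_trans (leZ _ _ _ (sumZ _ _ Yf)).
    by rewrite scalerA mulVf// scale1r.
  by rewrite invr_eq0.
- rewrite !nrm_sumYE -lerBlDr; apply: (le_Kfun Yf) => p [p0 p1 fE].
  rewrite lerBlDr [leRHS]addrC -lerBlDr; apply: (le_Kfun Yg) => q [q0 q1 gE].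
  rewrite lerBlDr; apply: le_trans (@Kfun_le _ 1 (p.1 + q.1, p.2 + q.2) ler01 _) _.
    by split; rewrite /= ?fE ?gE 1?addrACA//; exact: carD.
  rewrite /= !mul1r; apply: le_trans (lerD (nrmD s0 p0 q0) (nrmD s1 p1 q1)) _.
  by rewrite addrACA [leLHS]addrC.
Qed.

Lemma car_cap_sum f : car (capY Y0 Y1) f -> car (sumY Y0 Y1) f.
Proof.
by move=> [f0 f1]; exists (f, 0); split; rewrite /= ?addr0//; exact: car0.
Qed.

Lemma nrm_sum_le_cap f : car (capY Y0 Y1) f ->
  nrm (sumY Y0 Y1) f <= nrm (capY Y0 Y1) f.
Proof.
move=> [f0 f1]; rewrite nrm_sumYE.
apply: le_trans (@Kfun_le f 1 (f, 0) ler01 _) _.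
  by split; rewrite /= ?addr0//; exact: car0.
by rewrite /= nrm0// mulr0 addr0 le_max lexx.
Qed.

End sum.

(** A sequence that is Cauchy in both norms has limits x in X0 and y in X1.
    Its image in E converges to i0 x and to i1 y, which coincide because E is
    Hausdorff. *)
Lemma complete_capY (hE : hausdorff_space E) (X0 X1 : completeNormedModType R)
    (i0 : {linear X0 -> E}) (i1 : {linear X1 -> E}) :
  continuous_embedding i0 -> continuous_embedding i1 ->
  complete_nspace (capY (embedded i0) (embedded i1)).
Proof.
move=> [inj0 c0] [inj1 c1] f Yf fC.
have lim (X : completeNormedModType R) (i : {linear X -> E}) : injective i ->
    continuous i -> (forall n, car (embedded i) (f n)) ->
    (forall e : R, 0 < e -> exists N, forall n m, (N <= n)%N -> (N <= m)%N ->
      nrm (embedded i) (f n - f m) < e) ->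
    exists x : X, f @ \oo --> i x /\
      (fun n : nat => nrm (embedded i) (i x - f n)) @ \oo --> (0 : R).
  move=> inj c carf C.
  have /choice[x xE] : forall n, exists y, i y = f n.
    by move=> n; have [y _ <-] := carf n; exists y.
  have xcvg : cvgn x.
    apply/cauchy_cvgP/cauchy_exP => e e0.
    have [N NC] := C e e0; exists (x N); exists N => // n /= Nn.
    have := NC N n (leqnn N) Nn.
    by rewrite -!xE -linearB embeddedE// -ball_normE.
  exists (limn x); split.
    rewrite (_ : f = i \o x); last by apply/funext => n /=; rewrite xE.
    by apply: cvg_comp xcvg _; exact: c.
  under eq_fun do rewrite -xE -linearB embeddedE//.
  apply/norm_cvg0P; rewrite -(subrr (limn x)).
  by apply: cvgB => //; exact: cvg_cst.
have C0 (e : R) : 0 < e -> exists N, forall n m, (N <= n)%N -> (N <= m)%N ->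
    nrm (embedded i0) (f n - f m) < e.
  move=> /fC[N NC]; exists N => n m Nn Nm.
  by have := NC n m Nn Nm; rewrite gt_max => /andP[].
have C1 (e : R) : 0 < e -> exists N, forall n m, (N <= n)%N -> (N <= m)%N ->
    nrm (embedded i1) (f n - f m) < e.
  move=> /fC[N NC]; exists N => n m Nn Nm.
  by have := NC n m Nn Nm; rewrite gt_max => /andP[].
have [x [fx nx]] := lim _ i0 inj0 c0 (fun n => (Yf n).1) C0.
have [y [fy ny]] := lim _ i1 inj1 c1 (fun n => (Yf n).2) C1.
have xy : i0 x = i1 y by apply: (cvg_unique hE fx fy).
exists (i0 x); first by split; [exists x|rewrite xy; exists y].
apply: (@squeeze_cvgr _ _ _ _ (cst 0) (fun n : nat =>
    nrm (embedded i0) (i0 x - f n) + nrm (embedded i1) (i0 x - f n))) => //.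
- near=> n.
  have s0 := seminormed_embedded inj0; have s1 := seminormed_embedded inj1.
  have n0 : 0 <= nrm (embedded i0) (i0 x - f n).
    by apply: (nrm_ge0 s0); apply: (carB s0); [exists x|exact: (Yf n).1].
  have n1 : 0 <= nrm (embedded i1) (i0 x - f n).
    apply: (nrm_ge0 s1); apply: (carB s1); last exact: (Yf n).2.
    by rewrite xy; exists y.
  by rewrite /= le_max n0 ge_max lerDl lerDr n0 n1.
- exact: cvg_cst.
- by rewrite -(addr0 (0 : R)); apply: cvgD => //; rewrite xy.
Unshelve. all: by end_near.
Qed.

End seminormed.

(** * Integrals of simple functions *)

Section simple_functions.
Context {R : realType} {E : topologicalLmodType R}.
Local Notation mu := (@lebesgue_measure R).
Implicit Types (I : set R) (Y : nspace R E).

(** The target is any type, so that a pair of simple functions is covered: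
    its levels form a common refinement of theirs. *)
Definition finite_levels (T : Type) I (p : R -> T) : Prop :=
  finite_set (range p) /\ forall q, measurable (I `&` p @^-1` [set q]).

Lemma le_mu (A B : set R) : measurable A -> measurable B -> A `<=` B ->
  (mu A <= mu B)%E.
Proof. by move=> mA mB AB; apply: le_measure => //; apply/mem_set. Qed.

Section levels.
Variables (T : choiceType) (I : set R) (p : R -> T).
Hypothesis lp : finite_levels I p.

Lemma finite_levels_bigcup (P : set T) :
  I `&` p @^-1` P = \bigcup_(q in range p `&` P) (I `&` p @^-1` [set q]).
Proof.
apply/seteqP; split => [t [It Pt]|t [q [_ Pq] [It pq]]].
  by exists (p t).
by split => //; rewrite /preimage/= pq.
Qed.

Lemma finite_levels_trivIset (D : set T) :
  trivIset D (fun q => I `&` p @^-1` [set q]).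
Proof. by move=> q q' _ _ [t [[_ <-] [_ <-]]]. Qed.

Lemma finite_levels_preimage (P : set T) : measurable (I `&` p @^-1` P).
Proof.
rewrite finite_levels_bigcup; apply: fin_bigcup_measurable => [|q _].
  exact: finite_setIl lp.1.
exact: lp.2.
Qed.

Lemma finite_levels_dom : measurable I.
Proof. by rewrite -(setIT I) -(preimage_setT p); exact: finite_levels_preimage. Qed.

Lemma finite_levels_comp (T' : Type) (h : T -> T') : finite_levels I (h \o p).
Proof.
split; first by rewrite -[range _](image_comp p h setT); apply: finite_image lp.1.
by move=> q; exact: (finite_levels_preimage [set x | h x = q]).
Qed.

Lemma finite_levels_measurable (h : T -> R) : measurable_fun I (h \o p).
Proof. by move=> _ V mV; exact: (finite_levels_preimage (h @^-1` V)). Qed.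

Lemma finite_levels_measure_preimage (P : set T) :
  (mu (I `&` p @^-1` P) =
   \sum_(q \in range p `&` P) mu (I `&` p @^-1` [set q]))%E.
Proof.
rewrite finite_levels_bigcup measure_fin_bigcup//.
- exact: finite_setIl lp.1.
- exact: finite_levels_trivIset.
- by move=> q _; exact: lp.2.
Qed.

Lemma finite_levels_integral (h : T -> R) : (forall t, I t -> 0 <= h (p t)) ->
  (\int[mu]_(t in I) (h (p t))%:E =
   \sum_(q \in range p) (h q)%:E * mu (I `&` p @^-1` [set q]))%E.
Proof.
move=> h0; have mI := finite_levels_dom.
have IE : I = \bigcup_(q in range p) (I `&` p @^-1` [set q]).
  rewrite -{1}(setIT I) -(preimage_setT p) finite_levels_bigcup.
  by rewrite setIT.
have {1}-> : I = \big[setU/set0]_(q <- fset_set (range p)) (I `&` p @^-1` [set q]).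
  by rewrite bigsetU_fset_set; [exact: IE|exact: lp.1].
rewrite fsbig_finite; last exact: lp.1.
rewrite ge0_integral_bigsetU//=.
- apply: eq_bigr => q _.
  transitivity (\int[mu]_(t in I `&` p @^-1` [set q]) cst (h q)%:E t)%E.
    by apply: eq_integral => t /set_mem[_ <-].
  by rewrite integral_cst//; exact: lp.2.
- exact: lp.2.
- exact: finite_levels_trivIset.
- rewrite bigsetU_fset_set; last exact: lp.1.
  rewrite -IE; apply/measurable_EFinP; exact: finite_levels_measurable.
- rewrite bigsetU_fset_set; last exact: lp.1.
  by move=> t [q _ [It _]]; rewrite lee_fin h0.
Qed.

End levels.

(** The integral of h o p can be computed over the levels of p, even if p
    is finer than h o p.  Linearity follows by taking for p a pair of simple
    functions. *)
Lemma simple_integralE (T : choiceType) I (p : R -> T) (h : T -> E) (s : R -> E) :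
  finite_levels I p -> finite_set (range s) -> (forall t, I t -> s t = h (p t)) ->
  (forall q, h q != 0 -> (mu (I `&` p @^-1` [set q]) < +oo)%E) ->
  simple_integral I s =
  \sum_(q \in range p) fine (mu (I `&` p @^-1` [set q])) *: h q.
Proof.
move=> lp fs sE hfin; pose S := range s `|` h @` range p.
have fS : finite_set S.
  by rewrite finite_setU; split => //; apply: finite_image lp.1.
have finp : finite_set (range p) := lp.1.
rewrite /simple_integral (fsbig_widen _ S)/=; [|by left|]; last first.
  move=> y [_ /= nsy]; rewrite (_ : _ `&` _ = set0) ?measure0 ?scale0r//.
  by rewrite -subset0 => t [_ sty]; apply: nsy; exists t.
have levelE y : fine (mu (I `&` s @^-1` [set y])) *: y =
    \sum_(q <- fset_set (range p))
      if h q == y then fine (mu (I `&` p @^-1` [set q])) *: h q else 0.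
  have [->|y0] := eqVneq y 0.
    rewrite scaler0 big1// => q _.
    by case: eqP => // ->; rewrite scaler0.
  rewrite (_ : I `&` _ = I `&` p @^-1` [set q | h q = y]); last first.
    apply/seteqP; split => t [It]; rewrite /preimage/= => hy; split => //=.
      by rewrite -sE.
    by rewrite sE.
  rewrite finite_levels_measure_preimage// fsbig_mkcondr fsbig_finite//=.
  rewrite -sum_fine; last first.
    move=> q _; case: ifPn => // /set_mem/= hq.
    by rewrite ge0_fin_numE// hfin// hq.
  rewrite scaler_suml; apply: eq_bigr => q _.
  rewrite (_ : (q \in _) = (h q == y)); last by apply/idP/eqP => [/set_mem|hq] //; exact/mem_set.
  by case: eqP => [<-//|_]; rewrite scale0r.
under eq_fsbigr do rewrite levelE.
rewrite fsbig_finite// exchange_big/= [RHS]fsbig_finite//; apply: eq_big_seq => q.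
rewrite in_fset_set// => /set_mem pq.
rewrite (bigD1_seq (h q)) ?fset_uniq//=; last first.
  by rewrite in_fset_set// mem_set//; right; exists q.
rewrite eqxx big1 ?addr0// => y /negPf.
by rewrite eq_sym => ->.
Qed.

Lemma finite_levels_pair (T T' : choiceType) I (p : R -> T) (q : R -> T') :
  finite_levels I p -> finite_levels I q ->
  finite_levels I (fun t => (p t, q t)).
Proof.
move=> [fp mp] [fq mq]; split.
  apply: (@sub_finite_set _ _ (range p `*` range q)); last exact: finite_setX.
  by move=> _ [t _ <-]; split => /=; exists t.
move=> [x y]; rewrite (_ : _ `&` _ =
    (I `&` p @^-1` [set x]) `&` (I `&` q @^-1` [set y])).
  exact: measurableI.
apply/seteqP; split => [t [It [<- <-]]//|t [[It pt] [_ qt]]].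
by split => //; rewrite /preimage/= pt qt.
Qed.

Section integral_of_simple.
Variable Y : nspace R E.
Hypothesis Ysn : seminormed Y.

Lemma simple_on_levels I (s : R -> E) : finite_set (range s) ->
  simple_on I Y s -> finite_levels I s.
Proof. by move=> fs [_ ms]. Qed.

Lemma integrable_simple_sub I J (s : R -> E) : measurable J -> J `<=` I ->
  integrable_simple I Y s -> integrable_simple J Y s.
Proof.
move=> mJ JI [[cs ms] fs].
have ms' y : measurable (J `&` s @^-1` [set y]).
  by rewrite -(setIidl JI) -setIA; exact: measurableI.
split; first by split => // t /JI; exact: cs.
move=> y /fs; apply: le_lt_trans; apply: le_mu.
- exact: ms'.
- exact: ms.
- by move=> t [/JI It ty].
Qed.

Lemma integrable_simple_linear I (k : R) (s s' : R -> E) :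
  finite_set (range s) -> finite_set (range s') ->
  integrable_simple I Y s -> integrable_simple I Y s' ->
  [/\ finite_set (range (fun t => s t + k *: s' t)),
    integrable_simple I Y (fun t => s t + k *: s' t) &
    simple_integral I (fun t => s t + k *: s' t) =
      simple_integral I s + k *: simple_integral I s'].
Proof.
move=> fs fs' [ss is_] [ss' is'].
have ls := simple_on_levels fs ss; have ls' := simple_on_levels fs' ss'.
have lp := finite_levels_pair ls ls'.
have fin1 (q : E * E) : q.1 != 0 ->
    (mu (I `&` (fun t => (s t, s' t)) @^-1` [set q]) < +oo)%E.
  move=> /is_; apply: le_lt_trans; apply: le_mu.
  - exact: lp.2.
  - exact: ls.2.
  - by move=> t [It <-].
have fin2 (q : E * E) : q.2 != 0 ->
    (mu (I `&` (fun t => (s t, s' t)) @^-1` [set q]) < +oo)%E.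
  move=> /is'; apply: le_lt_trans; apply: le_mu.
  - exact: lp.2.
  - exact: ls'.2.
  - by move=> t [It <-].
have lh := finite_levels_comp lp (fun q => q.1 + k *: q.2).
have finh (q : E * E) : q.1 + k *: q.2 != 0 ->
    (mu (I `&` (fun t => (s t, s' t)) @^-1` [set q]) < +oo)%E.
  have [q10|/fin1//] := eqVneq q.1 0.
  have [q20|/fin2//] := eqVneq q.2 0.
  by rewrite q10 q20 scaler0 addr0 eqxx.
split; first exact: lh.1.
  split; first split.
  - by move=> t It; apply: (carD Ysn); [exact: ss.1|apply: carZ => //; exact: ss'.1].
  - exact: lh.2.
  - move=> y y0; have := finite_levels_measure_preimage lp [set q | q.1 + k *: q.2 = y].
    move=> ->; rewrite fsbig_finite/=; last exact: finite_setIl lp.1.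
    rewrite big_seq; apply: lte_sum_pinfty => q; rewrite in_fset_set; last exact: finite_setIl lp.1.
    by move=> /set_mem[_ /= qy]; apply: finh; rewrite qy.
rewrite (simple_integralE lp lh.1 _ finh)//.
rewrite (@simple_integralE _ I _ fst s lp fs _ fin1)//.
rewrite (@simple_integralE _ I _ snd s' lp fs' _ fin2)//.
have fp := lp.1.
rewrite !fsbig_finite// scaler_sumr -big_split/=; apply: eq_bigr => q _.
by rewrite scalerDr !scalerA mulrC.
Qed.

Lemma integrable_simple_setU I J (s : R -> E) : finite_set (range s) ->
  measurable I -> measurable J -> [disjoint I & J] ->
  integrable_simple (I `|` J) Y s ->
  simple_integral (I `|` J) s = simple_integral I s + simple_integral J s.
Proof.
move=> fs mI mJ IJ isU.
have [[cI msI] iI] := integrable_simple_sub mI (@subsetUl _ I J) isU.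
have [[cJ msJ] iJ] := integrable_simple_sub mJ (@subsetUr _ I J) isU.
rewrite /simple_integral !fsbig_finite// -big_split/=; apply: eq_bigr => y _.
have [->|y0] := eqVneq y 0; first by rewrite !scaler0 addr0.
rewrite -scalerDl setIUl measureU; [|exact: msI|exact: msJ|]; last first.
  rewrite -subset0 => t [[It _] [Jt _]].
  by move/disj_set2P : IJ => <-.
by rewrite fineD// ge0_fin_numE// ?iI ?iJ.
Qed.

Lemma simple_integral_extend I J (s s' : R -> E) : I `<=` J ->
  finite_set (range s) -> finite_set (range s') -> measurable I ->
  (forall t, I t -> s' t = s t) -> (forall t, J t -> ~ I t -> s' t = 0) ->
  integrable_simple I Y s -> simple_integral J s' = simple_integral I s.
Proof.
move=> IJ fs fs' mI s's s'0 [[cs ms] is_].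
have Is' q : I `&` s' @^-1` [set q] = I `&` s @^-1` [set q].
  by apply/seteqP; split => t [It]; rewrite /preimage/= => <-; split => //;
    rewrite /preimage/= s's.
rewrite (@simple_integralE _ I s' id s)//.
- rewrite /simple_integral; apply: eq_fsbigr => q _.
  have [->|q0] := eqVneq q 0; first by rewrite !scaler0.
  congr (fine (mu _) *: _); apply/seteqP; split => t [At st]; split => //.
    apply: contrapT => nIt; move: st; rewrite /preimage/= s'0// => qE.
    by rewrite -qE eqxx in q0.
  exact: IJ.
- by split => // q; rewrite Is'.
- by move=> t /s's.
- by move=> q q0; rewrite Is'; exact: is_.
Qed.

Lemma nrm_sum_le (T : Type) (r : seq T) (F : T -> E) :
  (forall i, car Y (F i)) ->
  car Y (\sum_(i <- r) F i) /\ nrm Y (\sum_(i <- r) F i) <= \sum_(i <- r) nrm Y (F i).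
Proof.
move=> cF; elim: r => [|i r [cr nr]].
  by rewrite !big_nil nrm0//; split => //; exact: car0.
rewrite !big_cons; split; first exact: carD.
by apply: le_trans (nrmD Ysn _ _) _ => //; rewrite lerD2l.
Qed.

(** The triangle inequality, term by term.  A value taken outside I only has
    an empty level in I, and need not lie in Y. *)
Lemma nrm_simple_integral_le I (s : R -> E) : finite_set (range s) ->
  integrable_simple I Y s ->
  car Y (simple_integral I s) /\
  ((nrm Y (simple_integral I s))%:E <= \int[mu]_(t in I) (nrm Y (s t))%:E)%E.
Proof.
move=> fs [ss is_]; have ls := simple_on_levels fs ss.
have levY y : car Y (fine (mu (I `&` s @^-1` [set y])) *: y).
  have [[t [It <-]]|] := pselect (exists t, I t /\ s t = y).
    by apply: carZ => //; exact: ss.1.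
  move=> /forallNP noty; rewrite (_ : _ `&` _ = set0).
    by rewrite measure0 scale0r; exact: car0.
  by rewrite -subset0 => t ts; apply: (noty t).
have := nrm_sum_le (fset_set (range s)) levY.
rewrite -fsbig_finite// => -[cs nle]; split => //.
rewrite (finite_levels_integral ls); last by move=> t It; apply: nrm_ge0 => //; exact: ss.1.
rewrite fsbig_finite//.
apply: (@le_trans _ _ (\sum_(i <- fset_set (range s))
    nrm Y (fine (mu (I `&` s @^-1` [set i])) *: i))%:E); first by rewrite lee_fin.
rewrite -sumEFin; apply: lee_sum => y _.
have [->|y0] := eqVneq y 0.
  by rewrite scaler0 nrm0// mul0e.
have [[t [It ty]]|] := pselect (exists t, I t /\ s t = y).
  rewrite nrmZ//; last by rewrite -ty; exact: ss.1.
  rewrite ger0_norm ?fine_ge0// EFinM muleC fineK//.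
  by rewrite ge0_fin_numE// is_.
move=> /forallNP noty; rewrite (_ : _ `&` _ = set0).
  by rewrite measure0 scale0r nrm0// mule0.
by rewrite -subset0 => t ts; apply: (noty t).
Qed.

End integral_of_simple.

End simple_functions.

(** * Strong measurability *)

Section strong_measurability.
Context {R : realType} {E : topologicalLmodType R}.
Local Notation mu := (@lebesgue_measure R).
Implicit Types (I J : set R) (Y : nspace R E).

Definition fimfun_of (f : R -> E) (fF : finite_set (range f)) :
  {fimfun R >-> E} := fimfun_Sub (mem_set fF).

(** Strong measurability with convergence everywhere on I.  It is reached by
    removing a null set from I, and makes norms Borel. *)
Definition pointwise_limit I Y (s : nat -> {fimfun R >-> E}) (u : R -> E) : Prop :=
  [/\ forall t, I t -> car Y (u t), forall n, simple_on I Y (s n) &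
      forall t, I t -> (fun n : nat => nrm Y (u t - s n t)) @ \oo --> (0 : R)].

Section basics.
Variable Y : nspace R E.
Hypothesis Ysn : seminormed Y.

Lemma squeeze0 (f g : nat -> R) : (forall n, 0 <= f n <= g n) ->
  g @ \oo --> (0 : R) -> f @ \oo --> (0 : R).
Proof.
move=> fg g0; apply: (@squeeze_cvgr _ _ _ _ (cst 0) g) => //.
- exact: nearW.
- exact: cvg_cst.
Qed.

Lemma simple_on_sub I J (s : R -> E) : measurable J -> J `<=` I ->
  simple_on I Y s -> simple_on J Y s.
Proof.
move=> mJ JI [cs ms]; split => [t /JI|y]; first exact: cs.
by rewrite -(setIidl JI) -setIA; exact: measurableI.
Qed.

Lemma strongly_measurable_limit I u : measurable I ->
  strongly_measurable I Y u ->
  exists (Z : set R) (s : nat -> {fimfun R >-> E}),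
    [/\ measurable Z, mu Z = 0, forall n, simple_on I Y (s n) &
    pointwise_limit (I `\` Z) Y s u].
Proof.
move=> mI [cu [s [ss [Z [mZ Z0 subZ]]]]]; exists Z, s; split => //; split.
- by move=> t [/cu].
- by move=> n; apply: simple_on_sub (ss n) => //; exact: measurableD.
- move=> t [It nZt]; apply: contrapT => nlim; apply: nZt; apply: subZ.
  by move=> /(_ It).
Qed.

Lemma simple_on_measurable I (s : R -> E) (h : E -> R) : finite_set (range s) ->
  simple_on I Y s -> measurable_fun I (h \o s).
Proof. by move=> fs [_ ms]; apply: finite_levels_measurable; split. Qed.

Lemma nrm_cvg f (g : nat -> E) : car Y f -> (forall n, car Y (g n)) ->
  (fun n : nat => nrm Y (f - g n)) @ \oo --> (0 : R) ->
  (fun n : nat => nrm Y (g n)) @ \oo --> nrm Y f.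
Proof.
move=> Yf Yg fg; apply: cvg_zero; apply/norm_cvg0P; apply: squeeze0 fg => n /=.
by rewrite normr_ge0/= distrC (nrm_dist Ysn).
Qed.

Lemma pointwise_limit_measurable I s u : pointwise_limit I Y s u ->
  measurable_fun I (fun t => nrm Y (u t)).
Proof.
move=> [cu ss su]; apply: (measurable_fun_cvg (h := fun n t => nrm Y (s n t))).
  move=> n; exact: (simple_on_measurable (nrm Y) _ (ss n)).
move=> t It; apply: nrm_cvg => //; first exact: cu.
- by move=> n; exact: (ss n).1.
- exact: su.
Qed.

Lemma finite_range_linear (k : R) (s s' : R -> E) :
  finite_set (range s) -> finite_set (range s') ->
  finite_set (range (fun t => s t + k *: s' t)).
Proof.
move=> fs fs'.
apply: (@sub_finite_set _ _ ((fun q : E * E => q.1 + k *: q.2) @`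
    (range s `*` range s'))); last exact/finite_image/finite_setX.
by move=> _ [t _ <-]; exists (s t, s' t) => //=; split; exists t.
Qed.

Lemma simple_on_linear I (k : R) (s s' : R -> E) :
  finite_set (range s) -> finite_set (range s') ->
  simple_on I Y s -> simple_on I Y s' ->
  simple_on I Y (fun t => s t + k *: s' t).
Proof.
move=> fs fs' ss ss'; split.
  move=> t It; apply: (carD Ysn); first exact: ss.1.
  by apply: (carZ Ysn); exact: ss'.1.
have lp := finite_levels_pair (simple_on_levels fs ss) (simple_on_levels fs' ss').
exact: (finite_levels_comp lp (fun q : E * E => q.1 + k *: q.2)).2.
Qed.

Lemma nrm_linear_le (k : R) f g f' g' : car Y f -> car Y g -> car Y f' ->
  car Y g' -> nrm Y ((f + k *: g) - (f' + k *: g')) <=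
    nrm Y (f - f') + `|k| * nrm Y (g - g').
Proof.
move=> Yf Yg Yf' Yg'; rewrite -(nrmZ Ysn); last exact: carB.
rewrite opprD addrACA -scalerBr.
by apply: (nrmD Ysn); [exact: carB|apply: (carZ Ysn); exact: carB].
Qed.

Lemma nrm_linear_cvg0 (k : R) f g (s s' : nat -> E) :
  car Y f -> car Y g -> (forall n, car Y (s n)) -> (forall n, car Y (s' n)) ->
  (fun n : nat => nrm Y (f - s n)) @ \oo --> (0 : R) ->
  (fun n : nat => nrm Y (g - s' n)) @ \oo --> (0 : R) ->
  (fun n : nat => nrm Y ((f + k *: g) - (s n + k *: s' n))) @ \oo --> (0 : R).
Proof.
move=> Yf Yg Ys Ys' fs gs.
have lim : (fun n => nrm Y (f - s n) + `|k| * nrm Y (g - s' n)) @ \oo --> (0 : R).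
  rewrite -(addr0 0) -{2}(mulr0 `|k|).
  by apply: cvgD => //; apply: cvgMr => //; exact: cvg_cst.
apply: squeeze0 lim => n; rewrite nrm_linear_le ?andbT//.
apply: (nrm_ge0 Ysn).
by apply: (carB Ysn); apply: (carD Ysn) => //; exact: (carZ Ysn).
Qed.

Lemma pointwise_limit_linear I (k : R) s s' u w :
  pointwise_limit I Y s u -> pointwise_limit I Y s' w ->
  exists r, pointwise_limit I Y r (fun t => u t + k *: w t).
Proof.
move=> [cu ss su] [cw ss' sw].
exists (fun n => fimfun_of (finite_range_linear k
  (@fimfunP _ _ (s n)) (@fimfunP _ _ (s' n)))).
split.
- by move=> t It; apply: (carD Ysn); [exact: cu|apply: (carZ Ysn); exact: cw].
- by move=> n; exact: simple_on_linear.
- move=> t It; apply: nrm_linear_cvg0; [exact: cu|exact: cw| | |exact: su|exact: sw].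
  + by move=> n; exact: (ss n).1.
  + by move=> n; exact: (ss' n).1.
Qed.

Lemma strongly_measurable_linear I (k : R) u w :
  strongly_measurable I Y u -> strongly_measurable I Y w ->
  strongly_measurable I Y (fun t => u t + k *: w t).
Proof.
move=> [cu [s [ss su]]] [cw [s' [ss' sw]]]; split.
  by move=> t It; apply: (carD Ysn); [exact: cu|apply: (carZ Ysn); exact: cw].
exists (fun n => fimfun_of (finite_range_linear k
  (@fimfunP _ _ (s n)) (@fimfunP _ _ (s' n)))); split.
  by move=> n; exact: simple_on_linear.
apply: filterS2 su sw; first exact: (ae_filter_ringOfSetsType mu).
move=> t sut swt It.
apply: nrm_linear_cvg0; [exact: cu|exact: cw| | |exact: sut|exact: swt].
- by move=> n; exact: (ss n).1.
- by move=> n; exact: (ss' n).1.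
Qed.

Lemma strongly_measurable_sub I J u : measurable J -> J `<=` I ->
  strongly_measurable I Y u -> strongly_measurable J Y u.
Proof.
move=> mJ JI [cu [s [ss su]]]; split; first by move=> t /JI; exact: cu.
exists s; split; first by move=> n; exact: simple_on_sub (ss n).
by apply: filterS su => [|t su /JI]; first exact: (ae_filter_ringOfSetsType mu).
Qed.

Lemma strongly_measurable_simple I (s : R -> E) : finite_set (range s) ->
  simple_on I Y s -> strongly_measurable I Y s.
Proof.
move=> fs ss; split; first exact: ss.1.
exists (fun=> fimfun_of fs); split => //.
apply: aeW => t It; rewrite subrr (nrm0 Ysn); exact: cvg_cst.
Qed.

Import HBNNSimple.

(** Products of approximating simple functions converge because
    phi u - f s = (phi - f) u + f (u - s). *)
Lemma strongly_measurable_scale I (phi : R -> R) u : measurable I ->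
  measurable_fun I phi -> (forall t, I t -> 0 <= phi t) ->
  strongly_measurable I Y u -> strongly_measurable I Y (fun t => phi t *: u t).
Proof.
move=> mI mphi phi0 [cu [s [ss su]]]; split.
  by move=> t It; apply: (carZ Ysn); exact: cu.
have mphi' : measurable_fun I (EFin \o phi) by exact/measurable_EFinP.
pose f := nnsfun_approx mI mphi'.
have fl n : finite_levels I (f n).
  split; first exact: fimfunP.
  by move=> q; apply: measurableI => //; exact: measurable_funPTI.
have fphi t : I t -> (fun n : nat => f n t) @ \oo --> phi t.
  move=> It; have := @cvg_nnsfun_approx _ _ _ _ mI _ mphi' _ t It.
  move=> /(_ _)/fine_cvgP[]//= x Ix; rewrite lee_fin; exact: phi0.
have lp n := finite_levels_pair (fl n) (simple_on_levels (@fimfunP _ _ (s n)) (ss n)).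
have lc n := finite_levels_comp (lp n) (fun q : R * E => q.1 *: q.2).
exists (fun n => fimfun_of (lc n).1); split.
  move=> n; split; last exact: (lc n).2.
  by move=> t It /=; apply: (carZ Ysn); exact: (ss n).1.
apply: filterS su; first exact: (ae_filter_ringOfSetsType mu).
move=> t /[swap] It /(_ It) sut.
apply: (@squeeze0 _ (fun n => `|phi t - f n t| * nrm Y (u t) +
    f n t * nrm Y (u t - s n t))).
  move=> n /=; have cut := cu t It; have cst := (ss n).1 t It.
  have -> : phi t *: u t - f n t *: s n t =
      (phi t - f n t) *: u t + f n t *: (u t - s n t).
    by rewrite scalerBl scalerBr addrA subrK.
  rewrite (nrm_ge0 Ysn); last first.
    by apply: (carD Ysn); apply: (carZ Ysn) => //; exact: (carB Ysn).
  have <- : nrm Y (f n t *: (u t - s n t)) = f n t * nrm Y (u t - s n t).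
    by rewrite (nrmZ Ysn) ?ger0_norm//; exact: (carB Ysn).
  rewrite andTb -(nrmZ Ysn)//.
  by apply: (nrmD Ysn); apply: (carZ Ysn) => //; exact: (carB Ysn).
have d0 : (fun n : nat => `|phi t - f n t|) @ \oo --> (0 : R).
  apply/norm_cvg0P; rewrite -(subrr (phi t)).
  by apply: cvgB; [exact: cvg_cst|exact: fphi].
have := cvgD (cvgM d0 (cvg_cst (nrm Y (u t)))) (cvgM (fphi t It) sut).
by rewrite mul0r mulr0 addr0 => h; exact: h.
Qed.

End basics.

End strong_measurability.

(** * Absolutely convergent Bochner integrals *)

Section bochner.
Context {R : realType} {E : topologicalLmodType R}.
Local Notation mu := (@lebesgue_measure R).
Implicit Types (I J : set R).

Variable Y : nspace R E.
Hypothesis Ysn : seminormed Y.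

Lemma pointwise_limit_dist_measurable I r (u s : R -> E) (fs : finite_set (range s)) :
  pointwise_limit I Y r u -> simple_on I Y s ->
  measurable_fun I (fun t => nrm Y (u t - s t)).
Proof.
move=> ru ss.
have sl : pointwise_limit I Y (fun=> fimfun_of fs) s.
  split => //; first exact: ss.1.
  by move=> t It; rewrite subrr (nrm0 Ysn); exact: cvg_cst.
have [r' r'P] := pointwise_limit_linear Ysn (-1) ru sl.
have := pointwise_limit_measurable Ysn r'P.
by under eq_fun do rewrite scaleN1r.
Qed.

(** Triangle inequality through u.  The norms of u - s and u - s' are Borel
    off a null set, where their integrals can be added. *)
Lemma simple_integral_dist I u (s s' : R -> E) : measurable I ->
  strongly_measurable I Y u ->
  finite_set (range s) -> finite_set (range s') ->
  integrable_simple I Y s -> integrable_simple I Y s' ->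
  ((nrm Y (simple_integral I s - simple_integral I s'))%:E <=
   \int[mu]_(t in I) (nrm Y (u t - s t))%:E +
   \int[mu]_(t in I) (nrm Y (u t - s' t))%:E)%E.
Proof.
move=> mI su fs fs' is_ is'.
have [fl il SIE] := integrable_simple_linear Ysn (-1) fs fs' is_ is'.
have [Z [r [mZ Z0 _ ru]]] := strongly_measurable_limit mI su.
have cu t : I t -> car Y (u t) by exact: su.1.
have cs t : I t -> car Y (s t) by exact: is_.1.1.
have cs' t : I t -> car Y (s' t) by exact: is'.1.1.
have n0 (f g : R -> E) t : (forall t, I t -> car Y (f t)) ->
    (forall t, I t -> car Y (g t)) -> I t -> (0 <= (nrm Y (f t - g t))%:E)%E.
  move=> cf cg It; rewrite lee_fin; apply: (nrm_ge0 Ysn).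
  by apply: (carB Ysn); [exact: cf|exact: cg].
have := (nrm_simple_integral_le Ysn fl il).2.
rewrite SIE scaleN1r => /le_trans; apply.
under eq_integral do rewrite scaleN1r.
rewrite !(lebesgue_integral_setD_null mI mZ Z0); try by move=> t It; exact: n0.
have mIZ : measurable (I `\` Z) by exact: measurableD.
have IZI : I `\` Z `<=` I by move=> t [].
apply: le_trans (lower_integralD mu mIZ _ _ _).
- apply: lower_integral_mono => //.
  + by move=> t /IZI It; exact: n0.
  + by move=> t /IZI It; apply: adde_ge0; exact: n0.
  + move=> t /IZI It; rewrite -EFinD lee_fin (nrmB Ysn (cu t It) (cs t It)).
    by apply: (nrm_sub_triangle Ysn); auto.
- by move=> t /IZI It; exact: n0.
- by move=> t /IZI It; rewrite -lee_fin; exact: n0.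
- apply: (pointwise_limit_dist_measurable fs' ru).
  exact: simple_on_sub is'.1.
Qed.

(** The approximating simple functions are set to zero where their norm
    exceeds twice the norm of w, which gives the integrable majorant 3 |w| for
    dominated convergence, and where their norm is 0, so that by Markov's
    inequality the levels of non-zero values have finite measure. *)
Lemma bochner_approx I w : measurable I -> strongly_measurable I Y w ->
  (\int[mu]_(t in I) (nrm Y (w t))%:E < +oo)%E ->
  exists s : nat -> {fimfun R >-> E}, (forall n, integrable_simple I Y (s n)) /\
    (\int[mu]_(t in I) (nrm Y (w t - s n t))%:E)%E @[n --> \oo] --> 0%E.
Proof.
move=> mI mw wfin; have [Z [s [mZ Z0 sI sw]]] := strongly_measurable_limit mI mw.
pose I' := I `\` Z.
have mI' : measurable I' by exact: measurableD.
have I'I : I' `<=` I by move=> t [].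
have [cw ss sl] := sw.
have n0 t : I t -> 0 <= nrm Y (w t) by move=> It; apply/(nrm_ge0 Ysn)/mw.1.
have wfin' : (\int[mu]_(t in I') (nrm Y (w t))%:E < +oo)%E.
  by rewrite -(lebesgue_integral_setD_null mI mZ Z0) // => t /n0.
have mnw := pointwise_limit_measurable Ysn sw.
have mns n : measurable_fun I' (fun t => nrm Y (s n t)).
  exact: (simple_on_measurable (nrm Y) _ (ss n)).
pose A n := I' `&` [set t | 0 < nrm Y (s n t)] `&`
  (I' `&` [set t | nrm Y (s n t) <= 2 * nrm Y (w t)]).
have mA n : measurable (A n).
  apply: measurableI.
    rewrite (_ : _ `&` _ =
        I' `&` (fun t => nrm Y (s n t)) @^-1` `]0, +oo[%classic); last first.
      by apply/seteqP; split => t [It]; rewrite /preimage/= ?in_itv/= ?andbT => nt; split => //=; rewrite ?in_itv/= ?andbT.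
    exact: mns.
  apply: measurable_fun_le => //.
  by apply: measurable_funM.
have lA n : finite_levels I (fun t => t \in A n).
  split; first exact: finite_finset.
  move=> [].
    rewrite (_ : _ `&` _ = I `&` A n); first exact: measurableI.
    by apply/seteqP; split => t [It At]; split => //; [exact/set_mem|exact/mem_set].
  rewrite (_ : _ `&` _ = I `\` A n); first exact: measurableD.
  apply/seteqP; split => t [It nA]; split => //.
    by move=> /mem_set; rewrite nA.
  exact: memNset.
have lp n := finite_levels_pair (simple_on_levels (@fimfunP _ _ (s n)) (sI n)) (lA n).
have lc n := finite_levels_comp (lp n) (fun q : E * bool => if q.2 then q.1 else 0).
pose s' n := fimfun_of (lc n).1.
have s'A n t : A n t -> s' n t = s n t by move=> At; rewrite /s'/= mem_set.
have s'nA n t : ~ A n t -> s' n t = 0 by move=> At; rewrite /s'/= memNset.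
have s's n : simple_on I Y (s' n).
  split; last exact: (lc n).2.
  move=> t It; have [At|At] := pselect (A n t); last by rewrite s'nA//; exact: car0.
  by rewrite s'A//; exact: (sI n).1.
have ints' n : integrable_simple I Y (s' n).
  split; first exact: s's.
  move=> y y0; have [ny|ny] := ltP 0 (nrm Y y); last first.
    rewrite (_ : _ `&` _ = set0) ?measure0// -subset0 => t [It sty].
    have {}sty : s' n t = y := sty.
    have [At|/s'nA s0] := pselect (A n t); last by rewrite -sty s0 eqxx in y0.
    have [[_ /= st0] _] := At.
    by move: sty st0; rewrite s'A// => ->; rewrite ltNge ny.
  pose B := I' `&` [set t | ((nrm Y y / 2)%:E <= `|(nrm Y (w t))%:E|)%E].
  have a0 : 0 < nrm Y y / 2 by rewrite divr_gt0.
  have mB : measurable B.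
    apply: emeasurable_fun_c_infty => //.
    by apply: measurableT_comp => //; exact/measurable_EFinP.
  apply: (@le_lt_trans _ _ (mu B)).
    apply: le_mu => //; first exact: (s's n).2.
    move=> t [It sty]; have {}sty : s' n t = y := sty.
    have [At|/s'nA s0] := pselect (A n t); last first.
      by move: y0; rewrite -sty s0 eqxx.
    move: sty; rewrite s'A// => sty.
    have [[I't _] [_ /=]] := At; rewrite sty => yw; split => //=.
    by rewrite lee_fin ger0_norm ?ler_pdivrMr 1?mulrC// n0.
  apply: (@le_lt_trans _ _ ((nrm Y y / 2)^-1%:E *
      \int[mu]_(t in I') `|(nrm Y (w t))%:E|)%E).
    rewrite lee_pdivlMl//; apply: le_integral_abse => //.
    exact/measurable_EFinP.
  apply: lte_mul_pinfty; rewrite ?lee_fin ?invr_ge0 ?ltW//.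
  apply: le_lt_trans wfin'; apply: lower_integral_mono => // t It.
    by rewrite lee_fin; apply/n0/I'I.
  by rewrite gee0_abs// lee_fin; apply/n0/I'I.
exists s'; split => //.
have cs' n t : I t -> car Y (s' n t) by exact: (s's n).1.
have s'w n t : I' t -> nrm Y (s' n t) <= 2 * nrm Y (w t).
  move=> It; have [At|/s'nA ->] := pselect (A n t).
    by rewrite s'A//; case: At => _ [].
  by rewrite (nrm0 Ysn) mulr_ge0// n0//; exact: I'I.
under eq_fun => n.
  rewrite (lebesgue_integral_setD_null mI mZ Z0); last first.
    move=> t It; rewrite lee_fin; apply: (nrm_ge0 Ysn); apply: (carB Ysn).
      exact: mw.1.
    exact: cs'.
  over.
have [] := @dominated_convergence _ _ R mu I' mI'
  (fun n t => (nrm Y (w t - s' n t))%:E) (cst 0%E)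
  (fun t => (3 * nrm Y (w t))%:E).
- move=> n; apply/measurable_EFinP.
  apply: (pointwise_limit_dist_measurable (lc n).1 sw).
  exact: simple_on_sub (s's n).
- exact: measurable_cst.
- apply: aeW => t I't; apply: cvg_EFin; first by near=> n.
  have := n0 t (I'I _ I't); rewrite le_eqVlt => /predU1P[w0|w0].
    have s0 n : s' n t = 0.
      apply: s'nA => -[[_ /= +] [_ /=]].
      by rewrite -w0 mulr0 => /lt_le_trans /[apply]; rewrite ltxx.
    rewrite (_ : _ \o _ = cst 0); first exact: cvg_cst.
    by apply/funext => n; change (nrm Y (w t - s' n t) = 0); rewrite s0 subr0.
  apply: cvg_trans (sl t I't); apply: near_eq_cvg.
  have nst : (fun n : nat => nrm Y (s n t)) @ \oo --> nrm Y (w t).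
    apply: (nrm_cvg Ysn) (sl t I't); first exact: cw.
    by move=> n; exact: (ss n).1.
  near=> n; change (nrm Y (w t - s n t) = nrm Y (w t - s' n t)).
  rewrite s'A//; split; split => //=.
    by near: n; exact: (cvgr_gt _ nst).
  by near: n; apply: (cvgr_le _ nst); rewrite ltr_pMl// ltr1n.
- rewrite (_ : (fun t => _) = (fun t => 3%:E * (nrm Y (w t))%:E)%E); last first.
    by apply/funext => t; rewrite EFinM.
  apply: integrableZl => //; apply/integrableP; split.
    exact/measurable_EFinP.
  apply: le_lt_trans wfin'; apply: lower_integral_mono => // t It.
    by rewrite lee_fin; apply/n0/I'I.
  by rewrite gee0_abs// lee_fin; apply/n0/I'I.
- apply: aeW => t n I't; have cwt := cw t I't; have cst := cs' n t (I'I _ I't).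
  rewrite gee0_abs ?lee_fin; last by apply: (nrm_ge0 Ysn); exact: (carB Ysn).
  apply: (@le_trans _ _ (nrm Y (w t) + nrm Y (s' n t))).
    by rewrite -(nrmN Ysn cst); apply: (nrmD Ysn) => //; exact: (carN Ysn).
  by rewrite (_ : 3 = 1 + 2) ?natr1// mulrDl mul1r lerD2l s'w.
by move=> _ _; rewrite integral0.
Unshelve. all: by end_near. Qed.

Lemma integrable_simple0 I : measurable I ->
  simple_integral I (cst (0 : E) : R -> E) = 0 /\
  integrable_simple I Y (cst (0 : E) : R -> E).
Proof.
move=> mI; split.
  apply: fsbig1 => _ [t _ <-] /=; exact: scaler0.
split; first split.
- by move=> t _; exact: car0.
- move=> y; rewrite preimage_cst; case: ifP => _; first by rewrite setIT.
  by rewrite setI0; exact: measurable0.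
- move=> y /negPf y0; rewrite preimage_cst; case: ifP => [/set_mem/= y0'|_].
    by rewrite -y0' eqxx in y0.
  by rewrite setI0 measure0.
Qed.

(** By the preceding estimates the integrals of the approximating simple
    functions form a Cauchy sequence. *)
Lemma bochner_exists I w : complete_nspace Y -> measurable I ->
  strongly_measurable I Y w ->
  (\int[mu]_(t in I) (nrm Y (w t))%:E < +oo)%E ->
  exists g, exists s : nat -> {fimfun R >-> E},
  [/\ car Y g,
      ((nrm Y g)%:E <= \int[mu]_(t in I) (nrm Y (w t))%:E)%E,
      forall n, integrable_simple I Y (s n),
      (\int[mu]_(t in I) (nrm Y (w t - s n t))%:E)%E @[n --> \oo] --> 0%E &
      (fun n : nat => nrm Y (g - simple_integral I (s n))) @ \oo --> (0 : R)].
Proof.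
move=> Yc mI mw wfin; have [s [is_ sw]] := bochner_approx mI mw wfin.
pose G n := simple_integral I (s n).
have cG n : car Y (G n).
  exact: (nrm_simple_integral_le Ysn (@fimfunP _ _ (s n)) (is_ n)).1.
have small (e : R) : 0 < e -> exists N, forall n, (N <= n)%N ->
    (\int[mu]_(t in I) (nrm Y (w t - s n t))%:E < e%:E)%E.
  move=> e0; have [N _ NC] := sw _ (@open_ereal_lt' _ 0%E e%:E e0).
  by exists N => n; exact: NC.
have [e e0|g Yg gG] := Yc G cG.
  have [N NC] := small _ (divr_gt0 e0 (ltr0Sn R 1)); exists N => n m Nn Nm.
  rewrite -lte_fin (splitr e) EFinD.
  apply: le_lt_trans (simple_integral_dist mI mw (@fimfunP _ _ (s n))
    (@fimfunP _ _ (s m)) (is_ n) (is_ m)) _.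
  by apply: lteD; exact: NC.
exists g, s; split => //; apply/lee_addgt0Pr => e e0.
have e20 : 0 < e / 2 by rewrite divr_gt0.
have [N NC] := small _ e20.
have gN : \forall n \near \oo, nrm Y (g - G n) < e / 2 by exact: cvgr_lt gG _ e20.
have [n [Nn gn]] : exists n, (N <= n)%N /\ nrm Y (g - G n) < e / 2.
  have [M _ MC] := gN; exists (maxn N M); split; first exact: leq_maxl.
  by apply: MC; exact: leq_maxr.
have f0 : finite_set (range (cst (0 : E) : R -> E)) by exact: finite_image_cst.
have i0 := integrable_simple0 mI.
have := simple_integral_dist mI mw (@fimfunP _ _ (s n)) f0 (is_ n) i0.2.
rewrite i0.1 subr0; under [X in (_ <= _ + X)%E]eq_integral do rewrite subr0.
move=> Gn; apply: (@le_trans _ _ (nrm Y (G n) + nrm Y (g - G n))%:E).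
  by rewrite lee_fin (nrm_le_sub Ysn).
rewrite EFinD (splitr e) EFinD addeA; apply: leeD; last by rewrite lee_fin ltW.
apply: le_trans Gn _; rewrite addeC leeD2l//.
by apply: ltW; exact: NC.
Qed.

End bochner.

(** * Extension by zero *)

Section extension.
Context {R : realType} {E : topologicalLmodType R}.
Local Notation mu := (@lebesgue_measure R).
Implicit Types (I J : set R) (Y : nspace R E).

Definition zero_extension I (g : R -> E) : R -> E :=
  fun t => if t \in I then g t else 0.

Lemma zero_extension_in I g t : I t -> zero_extension I g t = g t.
Proof. by move=> It; rewrite /zero_extension mem_set. Qed.

Lemma zero_extension_out I g t : ~ I t -> zero_extension I g t = 0.
Proof. by move=> It; rewrite /zero_extension memNset. Qed.

Lemma zero_extension_range I (g : R -> E) : finite_set (range g) ->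
  finite_set (range (zero_extension I g)).
Proof.
move=> fg; apply: (@sub_finite_set _ _ (0 |` range g)).
  move=> _ [t _ <-]; have [It|It] := pselect (I t).
    by right; exists t; rewrite // zero_extension_in.
  by left; rewrite zero_extension_out.
by rewrite finite_setU; split.
Qed.

Variable Y : nspace R E.
Hypothesis Ysn : seminormed Y.
Variables I J : set R.
Hypotheses (mI : measurable I) (mJ : measurable J) (IJ : I `<=` J).

Lemma zero_extension_preimage (s : R -> E) y : y != 0 ->
  J `&` zero_extension I s @^-1` [set y] = I `&` s @^-1` [set y].
Proof.
move=> y0; apply/seteqP; split => t [At ty]; last first.
  by split; [exact: IJ|rewrite /preimage/= zero_extension_in].
have {}ty : zero_extension I s t = y := ty.
have [It|It] := pselect (I t).
  by split => //; rewrite /preimage/= -ty zero_extension_in.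
by move: y0; rewrite -ty zero_extension_out// eqxx.
Qed.

Lemma simple_on_extend (s : R -> E) : simple_on I Y s ->
  simple_on J Y (zero_extension I s).
Proof.
move=> [cs ms]; split.
  move=> t Jt; have [It|It] := pselect (I t).
    by rewrite zero_extension_in//; exact: cs.
  by rewrite zero_extension_out//; exact: car0.
move=> y; have [->|y0] := eqVneq y 0; last first.
  by rewrite zero_extension_preimage.
rewrite (_ : _ `&` _ = (I `&` s @^-1` [set 0]) `|` (J `\` I)).
  by apply: measurableU => //; exact: measurableD.
apply/seteqP; split => t.
  move=> [Jt t0]; have {}t0 : zero_extension I s t = 0 := t0.
  have [It|It] := pselect (I t); [left|by right].
  by split => //; rewrite /preimage/= -t0 zero_extension_in.
move=> [[It st]|[Jt It]]; split => //.
- exact: IJ.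
- by rewrite /preimage/= zero_extension_in.
- by rewrite /preimage/= zero_extension_out.
Qed.

Lemma strongly_measurable_extend u : strongly_measurable I Y u ->
  strongly_measurable J Y (zero_extension I u).
Proof.
move=> [cu [s [ss su]]]; split.
  move=> t Jt; have [It|It] := pselect (I t).
    by rewrite zero_extension_in//; exact: cu.
  by rewrite zero_extension_out//; exact: car0.
exists (fun n => fimfun_of (zero_extension_range I (@fimfunP _ _ (s n)))).
split; first by move=> n; exact: simple_on_extend.
apply: filterS su; first exact: (ae_filter_ringOfSetsType mu).
move=> t su Jt /=; have [It|It] := pselect (I t).
  by under eq_fun do rewrite !zero_extension_in//; exact: su.
under eq_fun do rewrite !zero_extension_out// subrr (nrm0 Ysn).
exact: cvg_cst.
Qed.

Lemma bochner_integral_extend g f : is_bochner_integral I Y g f ->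
  is_bochner_integral J Y (zero_extension I g) f.
Proof.
move=> [mg [s [is_ sg sf]]]; split; first exact: strongly_measurable_extend.
exists (fun n => fimfun_of (zero_extension_range I (@fimfunP _ _ (s n)))).
split.
- move=> n; split; first exact: simple_on_extend (is_ n).1.
  by move=> y y0; rewrite zero_extension_preimage//; exact: (is_ n).2.
- under eq_fun => n.
    rewrite (_ : integral _ _ _ = (\int[mu]_(t in I) (nrm Y (g t - s n t))%:E)%E).
      over.
    rewrite integral_mkcond [RHS]integral_mkcond; congr (integral _ _ _).
    apply/funext => t; rewrite /patch; have [It|It] := pselect (I t).
      by rewrite !mem_set ?zero_extension_in//=; [rewrite zero_extension_in|exact: IJ].
    rewrite (memNset It); case: ifPn => // _.
    by rewrite /= !zero_extension_out// subrr (nrm0 Ysn).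
  exact: sg.
- have SIE n : simple_integral J
      (fimfun_of (zero_extension_range I (@fimfunP _ _ (s n)))) =
      simple_integral I (s n).
    apply: (simple_integral_extend (Y := Y)) => //.
    + by move=> t It /=; rewrite zero_extension_in.
    + by move=> t _ It /=; rewrite zero_extension_out.
  by under eq_fun do rewrite SIE.
Qed.

End extension.

(** * J-spaces *)

Section J_spaces.
Context {R : realType} {E : topologicalLmodType R}.
Local Notation mu := (@lebesgue_measure R).
Local Notation I_oo := (`]0, +oo[%classic : set R).
Local Notation I_1 := (`]0, 1[%classic : set R).
Local Notation I_2 := (`[1, +oo[%classic : set R).

Lemma mem_I_oo (t : R) : I_oo t = (0 < t) :> Prop.
Proof. by rewrite /= in_itv/= andbT. Qed.

Lemma mem_I_1 (t : R) : I_1 t = (0 < t < 1) :> Prop.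
Proof. by rewrite /= in_itv. Qed.

Lemma mem_I_2 (t : R) : I_2 t = (1 <= t) :> Prop.
Proof. by rewrite /= in_itv/= andbT. Qed.

Lemma sub_I_1_oo : I_1 `<=` I_oo.
Proof. by move=> t; rewrite mem_I_1 mem_I_oo => /andP[]. Qed.

Lemma sub_I_2_oo : I_2 `<=` I_oo.
Proof. by move=> t; rewrite mem_I_2 mem_I_oo; exact: lt_le_trans. Qed.

Lemma disj_I_1_2 : [disjoint I_1 & I_2].
Proof.
apply/disj_set2P; rewrite -subset0 => t []; rewrite mem_I_1 mem_I_2.
by move=> /andP[_ t1]; rewrite leNgt t1.
Qed.

Lemma I_ooE : I_oo = I_1 `|` I_2.
Proof.
apply/seteqP; split => t; last by move=> [/sub_I_1_oo|/sub_I_2_oo].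
rewrite mem_I_oo => t0; have [t1|t1] := ltP t 1.
  by left; rewrite mem_I_1 t0.
by right; rewrite mem_I_2.
Qed.

Lemma simple_integral_cst I (y : E) :
  simple_integral I (cst y : R -> E) = fine (mu I) *: y.
Proof.
rewrite /simple_integral (_ : range _ = [set y]).
  by rewrite fsbig_set1 preimage_cst mem_set// setIT.
by apply/seteqP; split => [_ [t _ <-]//|_ ->]; exists 0.
Qed.

Lemma integrable_simple_cst I Y (y : E) : measurable I -> (mu I < +oo)%E ->
  car Y y -> integrable_simple I Y (cst y : R -> E).
Proof.
move=> mI Ioo cy.
have lev z : measurable (I `&` (cst y : R -> E) @^-1` [set z]).
  rewrite preimage_cst; case: ifP => _; first by rewrite setIT.
  by rewrite setI0; exact: measurable0.
split; first by split.
move=> z _; apply: le_lt_trans Ioo; apply: le_mu.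
- exact: lev.
- exact: mI.
- by move=> t [].
Qed.

Variables Y0 Y1 : nspace R E.
Hypotheses (s0 : seminormed Y0) (s1 : seminormed Y1).
Let scap := seminormed_capY s0 s1.
Let ssum := seminormed_sumY s0 s1.

Lemma Jfun_ge0 f (t : R) : 0 <= t -> car (capY Y0 Y1) f -> 0 <= Jfun Y0 Y1 f t.
Proof. by move=> t0 [f0 f1]; rewrite /Jfun le_max (nrm_ge0 s0). Qed.

Lemma JfunD f g (t : R) : 0 <= t -> car (capY Y0 Y1) f -> car (capY Y0 Y1) g ->
  Jfun Y0 Y1 (f + g) t <= Jfun Y0 Y1 f t + Jfun Y0 Y1 g t.
Proof.
move=> t0 [f0 f1] [g0 g1]; rewrite /Jfun ge_max; apply/andP; split.
  by apply: le_trans (nrmD s0 f0 g0) _; apply: lerD; rewrite le_max lexx.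
apply: (@le_trans _ _ (t * nrm Y1 f + t * nrm Y1 g)).
  by rewrite -mulrDr ler_wpM2l// (nrmD s1).
by apply: lerD; rewrite le_max lexx orbT.
Qed.

Lemma Jfun_le_cap f (t : R) : 0 <= t -> t <= 1 -> car (capY Y0 Y1) f ->
  Jfun Y0 Y1 f t <= nrm (capY Y0 Y1) f.
Proof.
move=> t0 t1 [f0 f1]; rewrite /Jfun ge_max; apply/andP; split.
  by rewrite le_max lexx.
rewrite le_max; apply/orP; right.
by rewrite ler_piMl// (nrm_ge0 s1).
Qed.

Lemma Jfun0 (t : R) : Jfun Y0 Y1 0 t = 0.
Proof. by rewrite /Jfun (nrm0 s0) (nrm0 s1) mulr0 maxxx. Qed.

Lemma Jrepresentation_extend f u : Jrepresentation Y0 Y1 I_1 f u ->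
  Jrepresentation Y0 Y1 I_oo f (zero_extension I_1 u).
Proof.
have m1 : measurable I_1 by exact: measurable_itv.
have moo : measurable I_oo by exact: measurable_itv.
move=> [mu_ bu]; split.
  exact: (strongly_measurable_extend scap m1 moo sub_I_1_oo).
have := bochner_integral_extend ssum m1 moo sub_I_1_oo bu.
congr is_bochner_integral; apply/funext => t.
have [It|It] := pselect (I_1 t); first by rewrite !zero_extension_in.
by rewrite !zero_extension_out// scaler0.
Qed.

Lemma Jnorm_extend_le (v : R -> R) f :
  (Jnorm Y0 Y1 I_oo v f <= Jnorm Y0 Y1 I_1 v f)%E.
Proof.
apply: le_ereal_inf_tmp => _ [u ru <-].
apply: (@le_trans _ _
  (norm1 I_oo (fun t => t^-1 * v t * Jfun Y0 Y1 (zero_extension I_1 u t) t))).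
  apply: ereal_inf_lbound; exists (zero_extension I_1 u) => //.
  exact: Jrepresentation_extend.
rewrite /norm1 integral_mkcond [leRHS]integral_mkcond.
apply: lower_integral_mono => // t _; rewrite /patch.
- by case: ifP.
- by case: ifP.
- have [It|It] := pselect (I_1 t).
    by rewrite !mem_set//; [rewrite zero_extension_in|exact: sub_I_1_oo].
  by rewrite (memNset It); case: ifPn => // _;
    rewrite zero_extension_out// Jfun0 mulr0 normr0.
Qed.

Variables (v : R -> R) (M kappa : R).
Hypotheses (v_ge0 : forall t, 0 < t -> 0 <= v t).
Hypothesis v_le : forall t, 2^-1 < t -> t < 1 -> v t <= M.
Hypothesis kappa_gt0 : 0 < kappa.
(** Beyond 1 the weighted J-functional controls the norm of the intersection,
    which makes the tail of a representation absolutely convergent there. *)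
Hypothesis v_cap : forall t f, 1 <= t -> car (capY Y0 Y1) f ->
  kappa * nrm (capY Y0 Y1) f <= v t * Jfun Y0 Y1 f t.
Hypothesis cap_complete : complete_nspace (capY Y0 Y1).

Local Notation Jcost I u :=
  (norm1 I (fun t : R => (t^-1 * v t * Jfun Y0 Y1 (u t) t)%R)).

Lemma v_bound_ge0 : 0 <= M.
Proof.
have h1 : 2^-1 < (3 / 4 : R) by lra.
by apply: le_trans (v_le h1 _); [apply: v_ge0|]; lra.
Qed.

Lemma truncation_constant_gt0 : 0 < 1 + 2 * M / kappa.
Proof.
by rewrite ltr_pwDl// divr_ge0 ?mulr_ge0 ?v_bound_ge0// ltW.
Qed.

(** On [1,oo) the norm of u(t)/t in the intersection is at most 1/kappa times
    the integrand of the cost of u. *)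
Lemma tail_integral f u : Jrepresentation Y0 Y1 I_oo f u ->
  (Jcost I_oo u < +oo)%E ->
  exists g, exists s : nat -> {fimfun R >-> E},
  [/\ car (capY Y0 Y1) g,
      ((nrm (capY Y0 Y1) g)%:E <= kappa^-1%:E *
        Jcost I_oo u)%E,
      forall n, integrable_simple I_2 (capY Y0 Y1) (s n),
      (\int[mu]_(t in I_2) (nrm (capY Y0 Y1) (t^-1 *: u t - s n t)%R)%:E)%E
        @[n --> \oo] --> 0%E &
      (fun n : nat => nrm (capY Y0 Y1) (g - simple_integral I_2 (s n)))
        @ \oo --> (0 : R)].
Proof.
move=> [mu_ _] Nfin; set N := Jcost _ _.
have m2 : measurable I_2 by exact: measurable_itv.
have minv : measurable_fun I_2 (fun t : R => t^-1).
  apply: (measurable_funS (E := I_oo)) => //; first exact: sub_I_2_oo.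
  apply: open_continuous_measurable_fun; first exact: interval_open.
  move=> t /set_mem; rewrite mem_I_oo => t0; apply: inv_continuous.
  by rewrite gt_eqF.
have mw : strongly_measurable I_2 (capY Y0 Y1) (fun t => t^-1 *: u t).
  apply: strongly_measurable_scale => //.
    by move=> t; rewrite mem_I_2 => t1; rewrite invr_ge0 (le_trans ler01).
  exact: (strongly_measurable_sub m2 sub_I_2_oo mu_).
have wN : (\int[mu]_(t in I_2) (nrm (capY Y0 Y1) (t^-1 *: u t)%R)%:E <=
    kappa^-1%:E * N)%E.
  apply: (@le_trans _ _ (\int[mu]_(t in I_oo)
      (kappa^-1%:E * (`|t^-1 * v t * Jfun Y0 Y1 (u t) t|)%R%:E))%E); last first.
    apply: lower_integralZl; rewrite ?invr_gt0//.
  apply: lower_integral_mono => [|t /(mw.1 t) ct|t _|t].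
  - exact: sub_I_2_oo.
  - by rewrite lee_fin (nrm_ge0 scap).
  - by rewrite -EFinM lee_fin mulr_ge0// invr_ge0 ltW.
  - move=> It; have t0 : 0 < t by rewrite -mem_I_oo; exact: sub_I_2_oo.
    have cu : car (capY Y0 Y1) (u t) by apply: mu_.1; exact: sub_I_2_oo.
    rewrite -EFinM lee_fin ler_pdivlMl// (nrmZ scap)// gtr0_norm ?invr_gt0//.
    rewrite ger0_norm; last first.
      by rewrite !mulr_ge0 ?invr_ge0 ?Jfun_ge0 ?v_ge0 ?ltW.
    rewrite mulrCA -mulrA ler_wpM2l ?invr_ge0 ?(ltW t0)//.
    by apply: v_cap => //; rewrite -mem_I_2.
have wfin : (\int[mu]_(t in I_2) (nrm (capY Y0 Y1) (t^-1 *: u t)%R)%:E < +oo)%E.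
  by apply: le_lt_trans wN _; rewrite lte_mul_pinfty// ?lee_fin ?invr_ge0 ?ltW.
have [g [s [cg gN is_ sw sg]]] := bochner_exists scap cap_complete m2 mw wfin.
by exists g, s; split => //; exact: le_trans gN wN.
Qed.

Local Notation half := (`]2^-1, 1[%classic : set R).

Lemma mem_half (t : R) : half t = (2^-1 < t < 1) :> Prop.
Proof. by rewrite /= in_itv. Qed.

Lemma sub_half_I_1 : half `<=` I_1.
Proof.
move=> t; rewrite mem_half mem_I_1 => /andP[t2 ->]; rewrite andbT.
by apply: lt_trans t2; rewrite invr_gt0.
Qed.

Lemma half_measure : mu half = 2^-1%:E.
Proof.
rewrite lebesgue_measure_itv/= lte_fin ifT; last by rewrite invf_lt1 ?ltr1n.
by rewrite -EFinB; congr EFin; rewrite {1}(splitr 1) div1r addrK.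
Qed.

Section bump.
Variable g : E.
Hypothesis cg : car (capY Y0 Y1) g.

(** The value 2 g on an interval of length 1/2 has integral g.  As the
    integration is with respect to dt/t, the representation is corrected by
    t *: bump t. *)
Definition bump : R -> E := zero_extension half (cst (2 *: g)).

Lemma bump_range : finite_set (range bump).
Proof. by apply: zero_extension_range; exact: finite_image_cst. Qed.

Lemma bump_integrable : integrable_simple I_1 (capY Y0 Y1) bump.
Proof.
have c2g : car (capY Y0 Y1) (2 *: g) by exact: (carZ scap).
have mh : measurable half by exact: measurable_itv.
have m1 : measurable I_1 by exact: measurable_itv.
have [ss fs] : integrable_simple half (capY Y0 Y1) (cst (2 *: g) : R -> E).
  by apply: integrable_simple_cst => //; rewrite half_measure ltry.
split; first exact: (simple_on_extend scap mh m1 sub_half_I_1 ss).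
by move=> y y0; rewrite (zero_extension_preimage sub_half_I_1)//; exact: fs.
Qed.

Lemma bump_integral : simple_integral I_1 bump = g.
Proof.
have mh : measurable half by exact: measurable_itv.
have ih : integrable_simple half (capY Y0 Y1) (cst (2 *: g) : R -> E).
  apply: integrable_simple_cst => //; rewrite ?half_measure ?ltry//.
  exact: (carZ scap).
rewrite (simple_integral_extend sub_half_I_1 _ bump_range mh _ _ ih).
- by rewrite simple_integral_cst half_measure/= scalerA mulVf ?scale1r.
- exact: finite_image_cst.
- by move=> t ht; rewrite /bump zero_extension_in.
- by move=> t _ ht; rewrite /bump zero_extension_out.
Qed.

Lemma bump_cost (t : R) : I_1 t ->
  t^-1 * v t * Jfun Y0 Y1 (t *: bump t) t <= 2 * M * nrm (capY Y0 Y1) g.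
Proof.
move=> I1t; have := I1t; rewrite mem_I_1 => /andP[t0 t1].
have [ht|ht] := pselect (half t); last first.
  rewrite /bump zero_extension_out// scaler0 Jfun0 mulr0.
  by rewrite !mulr_ge0 ?v_bound_ge0// (nrm_ge0 scap).
have := ht; rewrite mem_half => /andP[t2 _].
rewrite /bump zero_extension_in// /cst.
have cbt : car (capY Y0 Y1) (t *: (2 *: g)) by apply: (carZ scap); exact: (carZ scap).
apply: (@le_trans _ _ (t^-1 * v t * (t * (2 * nrm (capY Y0 Y1) g)))).
  apply: ler_wpM2l; first by rewrite mulr_ge0 ?invr_ge0 ?v_ge0// ltW.
  apply: le_trans (Jfun_le_cap (ltW t0) (ltW t1) cbt) _.
  rewrite !(nrmZ scap)//; last exact: (carZ scap).
  by rewrite (gtr0_norm t0) normr_nat.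
rewrite mulrACA mulVf ?gt_eqF// mul1r [2 * M]mulrC -mulrA.
by rewrite ler_wpM2r ?(v_le t2 t1)// mulr_ge0// (nrm_ge0 scap).
Qed.

End bump.

(** The simple functions for the corrected integrand are those for u(t)/t
    restricted to (0,1), plus the bump.  Their integrals over (0,1) are the
    integrals over (0,oo) minus those over [1,oo), plus g, and the integrals
    over [1,oo) converge to g in the sum because there the norm is at most
    that of the intersection. *)
Lemma Jrepresentation_truncate f u : car (sumY Y0 Y1) f ->
  Jrepresentation Y0 Y1 I_oo f u -> (Jcost I_oo u < +oo)%E ->
  exists2 u', Jrepresentation Y0 Y1 I_1 f u' &
    (Jcost I_1 u' <= (1 + 2 * M / kappa)%:E * Jcost I_oo u)%E.
Proof.
move=> cf ru ufin; have [g [s' [cg gN is' sw' sg']]] := tail_integral ru ufin.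
have m1 : measurable I_1 by exact: measurable_itv.
have m2 : measurable I_2 by exact: measurable_itv.
have [mu_ [mw [s [is_ sw sf]]]] := ru.
have ib := bump_integrable cg.
have cap_sum h : car (capY Y0 Y1) h -> car (sumY Y0 Y1) h by exact: car_cap_sum.
have ib' : integrable_simple I_1 (sumY Y0 Y1) (bump g).
  by case: ib => -[cb mb] fb; split => //; split => // t /cb /cap_sum.
have is1 n : integrable_simple I_1 (sumY Y0 Y1) (s n).
  exact: (integrable_simple_sub m1 sub_I_1_oo (is_ n)).
have is2 n : integrable_simple I_2 (sumY Y0 Y1) (s n).
  exact: (integrable_simple_sub m2 sub_I_2_oo (is_ n)).
have mw1 := strongly_measurable_sub m1 sub_I_1_oo mw.
have mw2 := strongly_measurable_sub m2 sub_I_2_oo mw.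
have mb : strongly_measurable I_1 (capY Y0 Y1) (bump g).
  by apply: (strongly_measurable_simple scap (bump_range g)); exact: ib.1.
exists (fun t => u t + 1 *: (t *: bump g t)).
  split.
    apply: (strongly_measurable_linear scap).
      exact: (strongly_measurable_sub m1 sub_I_1_oo mu_).
    apply: (strongly_measurable_scale scap m1 _ _ mb) => [|t].
      exact: measurable_id.
    by rewrite mem_I_1 => /andP[/ltW].
  have -> : (fun t => t^-1 *: (u t + 1 *: (t *: bump g t))) =
      (fun t => t^-1 *: u t + 1 *: bump g t).
    apply/funext => t; rewrite !scale1r scalerDr; congr (_ + _).
    have [->|t0] := eqVneq t 0; last by rewrite scalerA mulVf// scale1r.
    rewrite scale0r scaler0 /bump zero_extension_out//.
    by rewrite mem_half => /andP[]; rewrite invr_lt0 ltrn0.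
  have lin n := integrable_simple_linear ssum 1 (@fimfunP _ _ (s n))
    (bump_range g) (is1 n) ib'.
  have fr n : finite_set (range (fun t => s n t + 1 *: bump g t)) by have [] := lin n.
  split.
    apply: (strongly_measurable_linear ssum) => //.
    exact: (strongly_measurable_simple ssum (bump_range g) ib'.1).
  exists (fun n => fimfun_of (fr n)); split.
  - by move=> n; have [] := lin n.
  - apply: (@squeeze_cvge _ _ _ _ (cst 0%E) _ (fun n =>
      (\int[mu]_(t in I_oo)
        (nrm (sumY Y0 Y1) (t^-1 *: u t - s n t)%R)%:E)%E)) => //; last first.
      exact: cvg_cst.
    apply: nearW => n.
    have nn t : I_oo t -> (0 <= (nrm (sumY Y0 Y1) (t^-1 *: u t - s n t)%R)%:E)%E.
      move=> It; rewrite lee_fin; apply: (nrm_ge0 ssum); apply: (carB ssum).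
        exact: mw.1.
      exact: (is_ n).1.1.
    under eq_integral do rewrite /= opprD addrACA subrr addr0.
    apply/andP; split.
      by apply: integral_ge0 => t /sub_I_1_oo; exact: nn.
    by apply: lower_integral_mono => // [|t /sub_I_1_oo]; [exact: sub_I_1_oo|exact: nn].
  - pose G n := simple_integral I_2 (s' n).
    have cG n : car (capY Y0 Y1) (G n).
      exact: (nrm_simple_integral_le scap (@fimfunP _ _ (s' n)) (is' n)).1.
    have c1 n : car (sumY Y0 Y1) (simple_integral I_1 (s n)).
      exact: (nrm_simple_integral_le ssum (@fimfunP _ _ (s n)) (is1 n)).1.
    have c2 n : car (sumY Y0 Y1) (simple_integral I_2 (s n)).
      exact: (nrm_simple_integral_le ssum (@fimfunP _ _ (s n)) (is2 n)).1.
    have is'2 n : integrable_simple I_2 (sumY Y0 Y1) (s' n).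
      by case: (is' n) => -[c m] h; split => //; split => // t /c /cap_sum.
    have SIE n : simple_integral I_oo (s n) =
        simple_integral I_1 (s n) + simple_integral I_2 (s n).
      rewrite I_ooE; apply: (integrable_simple_setU (Y := sumY Y0 Y1)) => //.
        exact: disj_I_1_2.
      by rewrite -I_ooE.
    pose P n := (\int[mu]_(t in I_oo)
      (nrm (sumY Y0 Y1) (t^-1 *: u t - s n t)%R)%:E)%E.
    pose Q n := (\int[mu]_(t in I_2)
      (nrm (capY Y0 Y1) (t^-1 *: u t - s' n t)%R)%:E)%E.
    have mwc t : I_2 t -> car (capY Y0 Y1) (t^-1 *: u t).
      by move=> /sub_I_2_oo It; apply: (carZ scap); exact: mu_.1.
    have bPQ n : ((nrm (sumY Y0 Y1) (simple_integral I_2 (s n) - G n))%:E <=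
        P n + Q n)%E.
      apply: le_trans (simple_integral_dist ssum m2 mw2 (@fimfunP _ _ (s n))
        (@fimfunP _ _ (s' n)) (is2 n) (is'2 n)) _.
      apply: leeD; apply: lower_integral_mono => //.
      - exact: sub_I_2_oo.
      - move=> t It; rewrite lee_fin; apply: (nrm_ge0 ssum); apply: (carB ssum).
          exact: mw2.1.
        exact: (is2 n).1.1.
      - move=> t It; rewrite lee_fin; apply: (nrm_ge0 ssum); apply: (carB ssum).
          exact: mw.1.
        exact: (is_ n).1.1.
      - move=> t It; rewrite lee_fin; apply: (nrm_ge0 ssum); apply: (carB ssum).
          exact: mw2.1.
        exact: (is'2 n).1.1.
      - move=> t It; rewrite lee_fin; apply: (nrm_ge0 scap); apply: (carB scap).
          exact: mwc.
        exact: (is' n).1.1.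
      - move=> t It; rewrite lee_fin; apply: (nrm_sum_le_cap s0 s1).
        by apply: (carB scap); [exact: mwc|exact: (is' n).1.1].
    pose D n := (nrm (sumY Y0 Y1) (f - simple_integral I_oo (s n)))%:E.
    pose C n := (nrm (capY Y0 Y1) (g - G n))%:E.
    have lim0 : (fun n => D n + (P n + Q n) + C n)%E @ \oo --> 0%E.
      rewrite -[X in _ --> X](adde0 0%E) -[X in _ --> (X + _)%E](adde0 0%E).
      rewrite -[X in _ --> (_ + X + _)%E](adde0 0%E).
      apply: cvgeD => //; [apply: cvgeD => //|].
      + by apply: cvg_EFin; [exact: nearW|exact: sf].
      + exact: cvgeD.
      + by apply: cvg_EFin; [exact: nearW|exact: sg'].
    (* The distance from f is split at the integral over (0,oo) of s n and at
       the integral over [1,oo) of s' n. *)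
    suff : (fun n => (nrm (sumY Y0 Y1) (f -
        simple_integral I_1 (fun t => s n t + 1 *: bump g t)))%:E) @ \oo --> 0%E.
      by move=> /fine_cvgP[].
    apply: (@squeeze_cvge _ _ _ _ (cst 0%E) _ _) lim0; last exact: cvg_cst.
    apply: nearW => n; have [_ _ ->] := lin n.
    have cg' := cap_sum _ cg; have cG' := cap_sum _ (cG n).
    have cI : car (sumY Y0 Y1) (simple_integral I_oo (s n)).
      by rewrite SIE; exact: (carD ssum).
    rewrite scale1r bump_integral//; apply/andP; split.
      rewrite lee_fin; apply: (nrm_ge0 ssum); apply: (carB ssum) => //.
      exact: (carD ssum).
    apply: (@le_trans _ _ (nrm (sumY Y0 Y1) (f - simple_integral I_oo (s n)) +
      nrm (sumY Y0 Y1) (simple_integral I_2 (s n) - G n) +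
      nrm (sumY Y0 Y1) (g - G n))%:E).
      rewrite lee_fin (nrmB ssum cg' cG').
      have -> : f - (simple_integral I_1 (s n) + g) =
          (f - simple_integral I_oo (s n)) +
          (simple_integral I_2 (s n) - G n) + (G n - g).
        have BC : (simple_integral I_2 (s n) - G n) + (G n - g) =
            simple_integral I_2 (s n) - g by rewrite addrA subrK.
        by rewrite SIE -[RHS]addrA BC !opprD !addrA subrK.
      have cd1 : car (sumY Y0 Y1) (f - simple_integral I_oo (s n)).
        exact: (carB ssum).
      have cd2 : car (sumY Y0 Y1) (simple_integral I_2 (s n) - G n).
        exact: (carB ssum).
      apply: le_trans (nrmD ssum (carD ssum cd1 cd2) (carB ssum cG' cg')) _.
      by rewrite lerD2r; exact: (nrmD ssum).
    rewrite !EFinD; apply: leeD.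
      by apply: leeD => //; exact: bPQ.
    by rewrite lee_fin; apply: (nrm_sum_le_cap s0 s1); exact: (carB scap).
(* On (0,1) the integrand of the cost of the bump is at most K. *)
pose K := 2 * M * nrm (capY Y0 Y1) g.
have M0 := v_bound_ge0.
have K0 : 0 <= K by rewrite !mulr_ge0// (nrm_ge0 scap).
have N0 : (0 <= Jcost I_oo u)%E by apply: integral_ge0 => t _; rewrite lee_fin.
apply: (@le_trans _ _ (\int[mu]_(t in I_1)
    ((`|t^-1 * v t * Jfun Y0 Y1 (u t) t|)%R%:E + (cst K t)%:E))%E).
  apply: lower_integral_mono => // [t _|t It].
    by apply: adde_ge0; rewrite lee_fin.
  have := It; rewrite mem_I_1 => /andP[t0 t1].
  have cu : car (capY Y0 Y1) (u t) by apply: mu_.1; exact: sub_I_1_oo.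
  have cb : car (capY Y0 Y1) (t *: bump g t).
    by apply: (carZ scap); exact: ib.1.1.
  have tv0 : 0 <= t^-1 * v t by rewrite mulr_ge0 ?invr_ge0 ?v_ge0 ?ltW.
  rewrite -EFinD lee_fin scale1r !ger0_norm; last 2 first.
  - by rewrite mulr_ge0// Jfun_ge0// ltW.
  - by rewrite mulr_ge0// Jfun_ge0//; [exact: ltW|exact: (carD scap)].
  apply: (@le_trans _ _ (t^-1 * v t * (Jfun Y0 Y1 (u t) t +
      Jfun Y0 Y1 (t *: bump g t) t))).
    by apply: ler_wpM2l => //; apply: JfunD => //; exact: ltW.
  by rewrite mulrDr lerD2l; exact: bump_cost.
apply: le_trans (lower_integralD mu m1 _ _ _) _ => //.
have -> : (\int[mu]_(t in I_1) (cst K t)%:E = K%:E)%E.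
  transitivity (\int[mu]_(t in I_1) cst K%:E t)%E => //.
  transitivity (K%:E * mu I_1)%E; first exact: integral_cst.
  rewrite lebesgue_measure_itv/= lte_fin ltr01 oppr0 adde0.
  exact: mule1.
rewrite EFinD ge0_muleDl ?lee_fin//; last first.
  by rewrite divr_ge0 ?mulr_ge0// ltW.
rewrite mul1e; apply: leeD.
  by apply: lower_integral_mono => //; exact: sub_I_1_oo.
rewrite [leRHS](_ : _ =
    (2 * M)%:E * (kappa^-1%:E * Jcost I_oo u))%E; last by rewrite muleA -EFinM.
rewrite /K EFinM; apply: lee_pmul => //.
- by rewrite lee_fin mulr_ge0.
- by rewrite lee_fin (nrm_ge0 scap).
Qed.

Lemma Jnorm_truncate_le f : car (sumY Y0 Y1) f ->
  (Jnorm Y0 Y1 I_1 v f <=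
   (1 + 2 * M / kappa)%:E * Jnorm Y0 Y1 I_oo v f)%E.
Proof.
move=> cf; have C0 := truncation_constant_gt0.
rewrite -lee_pdivrMl//; apply: le_ereal_inf_tmp => _ [u ru <-].
rewrite lee_pdivrMl//.
have [->|ufin] := eqVneq (Jcost I_oo u) +oo%E.
  by rewrite gt0_muley ?lte_fin// leey.
have [|u' ru' u'C] := @Jrepresentation_truncate f u cf ru.
  by rewrite ltey.
by apply: le_trans u'C; apply: ereal_inf_lbound; exists u'.
Qed.

Lemma Jnorm_ge0 I f : (0 <= Jnorm Y0 Y1 I v f)%E.
Proof.
apply: le_ereal_inf_tmp => _ [u _ <-].
by apply: integral_ge0 => t _; rewrite lee_fin.
Qed.

Lemma Jspace_truncate :
  eq_nspace (Jspace Y0 Y1 I_oo v) (Jspace Y0 Y1 I_1 v).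
Proof.
have C0 := truncation_constant_gt0.
split.
  apply/seteqP; split => f [cf ff]; split => //=.
    apply: le_lt_trans (Jnorm_truncate_le cf) _.
    by rewrite lte_mul_pinfty// lee_fin ltW.
  exact: le_lt_trans (Jnorm_extend_le v f) ff.
exists 1, (1 + 2 * M / kappa); split => // f [cf ff] /=.
have f1 : (Jnorm Y0 Y1 I_1 v f < +oo)%E.
  apply: le_lt_trans (Jnorm_truncate_le cf) _.
  by rewrite lte_mul_pinfty// lee_fin ltW.
have oo_fin : Jnorm Y0 Y1 I_oo v f \is a fin_num by rewrite ge0_fin_numE ?Jnorm_ge0.
have I1_fin : Jnorm Y0 Y1 I_1 v f \is a fin_num by rewrite ge0_fin_numE ?Jnorm_ge0.
split.
  by rewrite mul1r fine_le// Jnorm_extend_le.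
rewrite -lee_fin EFinM !fineK//.
exact: Jnorm_truncate_le.
Qed.

End J_spaces.

(** * Stieltjes measure of an absolutely continuous function *)

Section absolutely_continuous_density.
Context {R : realType}.
Local Notation mu := (@lebesgue_measure R).
Variables (F : cumulative R R) (p q : R).
Hypotheses (pq : p < q) (acF : abs_continuous_on p q F).

Let nu := lebesgue_stieltjes_measure F.

Lemma stieltjes_itv (a b : R) : a <= b -> nu `]a, b]%classic = (F b - F a)%:E.
Proof.
move=> ab; rewrite /nu /lebesgue_stieltjes_measure/= /measure_extension/=.
rewrite measurable_mu_extE; last exact: is_ocitv.
exact: wlength_itv_bnd.
Qed.

Definition gridpoint (k j : nat) : R := p + (q - p) * (j%:R / (2 ^ k)%:R).

Definition cell (k j : nat) : set R := `]gridpoint k j, gridpoint k j.+1]%classic.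

Lemma gridpoint_le k i j : (i <= j)%N -> gridpoint k i <= gridpoint k j.
Proof.
move=> ij; rewrite lerD2l ler_wpM2l ?subr_ge0 ?(ltW pq)//.
by rewrite ler_wpM2r ?ler_nat// invr_ge0.
Qed.

Lemma gridpoint0 k : gridpoint k 0 = p.
Proof. by rewrite /gridpoint mul0r mulr0 addr0. Qed.

Lemma gridpoint_last k : gridpoint k (2 ^ k) = q.
Proof.
have n0 : (2 ^ k)%:R != 0 :> R by rewrite pnatr_eq0 expn_eq0.
by rewrite /gridpoint (mulfV n0) mulr1 addrC subrK.
Qed.

Lemma gridpoint_in k j : (j <= 2 ^ k)%N -> p <= gridpoint k j <= q.
Proof.
move=> jk; rewrite -{1}(gridpoint0 k) -(gridpoint_last k).
by rewrite !gridpoint_le.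
Qed.

Lemma gridpoint_double k j : gridpoint k.+1 j.*2 = gridpoint k j.
Proof.
by rewrite /gridpoint expnS -mul2n !natrM invfM mulrACA divff ?mul1r.
Qed.

Lemma gridpointS k j :
  gridpoint k j.+1 - gridpoint k j = (q - p) / (2 ^ k)%:R.
Proof. by rewrite /gridpoint -natr1; ring. Qed.

Lemma cellP k j x : cell k j x <-> gridpoint k j < x <= gridpoint k j.+1.
Proof. by rewrite /cell/= in_itv. Qed.

(** Bisection of a cell into the two cells of the next grid inside it. *)
Lemma cell_refine k j x : cell k j x ->
  exists i, [/\ (i < 2)%N, cell k.+1 (j.*2 + i) x &
    cell k.+1 (j.*2 + i) `<=` cell k j].
Proof.
have g1 : gridpoint k j <= gridpoint k.+1 j.*2.+1.
  by rewrite -(gridpoint_double k j) gridpoint_le.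
have g2 : gridpoint k.+1 j.*2.+1 <= gridpoint k j.+1.
  by rewrite -(gridpoint_double k j.+1) gridpoint_le// doubleS.
move=> /cellP /andP[jx xj]; have [xm|mx] := leP x (gridpoint k.+1 j.*2.+1).
  exists 0%N; rewrite addn0; split => //.
    by apply/cellP; rewrite gridpoint_double jx.
  move=> y /cellP; rewrite gridpoint_double => /andP[jy yj].
  by apply/cellP; rewrite jy (le_trans yj).
exists 1%N; rewrite addn1; split => //.
  by apply/cellP; rewrite mx -doubleS gridpoint_double.
move=> y /cellP; rewrite -doubleS gridpoint_double => /andP[jy yj].
by apply/cellP; rewrite yj (le_lt_trans g1).
Qed.

Lemma double_lt k j i : (j < 2 ^ k)%N -> (i < 2)%N -> (j.*2 + i < 2 ^ k.+1)%N.
Proof.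
move=> jk i2; rewrite expnS mul2n (@leq_trans j.+1.*2)//; last by rewrite leq_double.
by rewrite doubleS -addn2 -addnS leq_add2l.
Qed.

Lemma cell_cover k x : p < x <= q -> exists2 j, (j < 2 ^ k)%N & cell k j x.
Proof.
move=> pxq; elim: k => [|k [j jk jx]].
  exists 0%N => //; apply/cellP.
  by rewrite gridpoint0 -[X in gridpoint 0 X]/(2 ^ 0)%N gridpoint_last.
have [i [i2 ix _]] := cell_refine jx.
by exists (j.*2 + i)%N => //; exact: double_lt.
Qed.

Lemma cell_trivIset k : trivIset setT (cell k).
Proof.
apply/trivIsetP => i j _ _; wlog ij : i j / (i < j)%N.
  move=> H; rewrite neq_ltn => /orP[ij|ji]; first by rewrite H// ltn_eqF.
  by rewrite setIC H// ltn_eqF.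
move=> _; rewrite -subset0 => x [/cellP/andP[_ xi] /cellP/andP[jx _]].
by move: (lt_le_trans jx xi); rewrite ltNge gridpoint_le.
Qed.

Lemma measurable_cell k j : measurable (cell k j).
Proof. exact: measurable_itv. Qed.

Lemma cell_measure k j :
  mu (cell k j) = (gridpoint k j.+1 - gridpoint k j)%:E.
Proof.
rewrite /cell lebesgue_measure_itv/= lte_fin; case: ltP => [gj|gj].
  by rewrite EFinB.
have := gridpoint_le k (leqnSn j); rewrite le_eqVlt ltNge gj orbF => /eqP ->.
by rewrite subrr.
Qed.

Section grid_approximation.
Variable U : set R.

(** A finite union of disjoint intervals, to which the definition of absolute
    continuity applies directly.  These unions increase to the part of an open
    set U in the interval from p to q. *)
Definition grid_approx (k : nat) : set R :=
  \big[setU/set0]_(j < 2 ^ k | `[< cell k j `<=` U >]) cell k j.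

Lemma grid_approxP k x : grid_approx k x <->
  exists j, [/\ (j < 2 ^ k)%N, cell k j `<=` U & cell k j x].
Proof.
rewrite /grid_approx big_mkcond/=.
rewrite -(bigcup_mkord (2 ^ k) (fun j => if `[< cell k j `<=` U >] then cell k j else set0)).
split.
  move=> [j /= jk]; case: ifP => // /asboolP jU jx.
  by exists j.
by move=> [j [jk jU jx]]; exists j => //=; rewrite ifT//; apply/asboolP.
Qed.

Lemma grid_approx_nondecreasing : nondecreasing_seq grid_approx.
Proof.
apply/nondecreasing_seqP => k; apply/subsetPset => x /grid_approxP[j [jk jU jx]].
have [i [i2 ix iU]] := cell_refine jx.
apply/grid_approxP; exists (j.*2 + i)%N; split => //; first exact: double_lt.
exact: subset_trans iU jU.
Qed.

Lemma grid_approx_sub k : grid_approx k `<=` U.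
Proof. by move=> x /grid_approxP[j [_ jU /jU]]. Qed.

Lemma measurable_grid_approx k : measurable (grid_approx k).
Proof. by apply: bigsetU_measurable => j _; exact: measurable_cell. Qed.

Lemma grid_approx_cover : open U -> U `&` `]p, q]%classic `<=` \bigcup_k grid_approx k.
Proof.
move=> oU x [Ux]; rewrite /= in_itv/= => pxq.
have /nbhs_ballP[r /= r0 rU] : nbhs x U by exact: open_nbhs_nbhs.
have [k kr] : exists k : nat, (q - p) / (2 ^ k)%:R < r.
  exists (Num.bound ((q - p) / r)); set k := Num.bound _.
  rewrite ltr_pdivrMr ?ltr0n ?expn_gt0// -ltr_pdivrMl// mulrC.
  apply: lt_trans (archi_boundP _) _; first by rewrite divr_ge0 ?ltW ?subr_gt0.
  by rewrite ltr_nat ltn_expl.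
have [j jk jx] := cell_cover k pxq.
exists k => //; apply/grid_approxP; exists j; split => // y /cellP/andP[jy yj].
apply: rU; rewrite /ball/= ltr_norml.
move/cellP : jx => /andP[jx xj].
have := gridpointS k j; move: kr; set h := (q - p) / _ => hr gj.
by apply/andP; split; lra.
Qed.

Lemma grid_approx_stieltjes (e d : R) k :
  (forall (n : nat) (l r : 'I_n -> R),
      (forall i, p <= l i /\ l i <= r i /\ r i <= q) ->
      trivIset [set: 'I_n] (fun i => `]l i, r i[%classic) ->
      \sum_(i < n) (r i - l i) < d ->
      \sum_(i < n) `|F (r i) - F (l i)| < e) ->
  (mu U < d%:E)%E -> measurable U -> (nu (grid_approx k) <= e%:E)%E.
Proof.
move=> ac Ud mU; pose P (j : 'I_(2 ^ k)) := `[< cell k j `<=` U >].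
have tP : trivIset P (fun j : 'I_(2 ^ k) => cell k j).
  by move=> i j _ _ /(cell_trivIset Logic.I Logic.I)/val_inj.
have muE : mu (grid_approx k) =
    (\sum_(j < 2 ^ k | P j) (gridpoint k j.+1 - gridpoint k j))%:E.
  rewrite /grid_approx (measure_bigsetU_ord_cond mu)//; last first.
    by move=> j _; exact: measurable_cell.
  by rewrite -sumEFin; apply: eq_bigr => j _; exact: cell_measure.
have nuE : nu (grid_approx k) =
    (\sum_(j < 2 ^ k | P j) (F (gridpoint k j.+1) - F (gridpoint k j)))%:E.
  transitivity (\sum_(j < 2 ^ k | P j) nu (cell k j))%E.
    apply: measure_bigsetU_ord_cond => //.
    by move=> j _; exact: measurable_cell.
  rewrite -sumEFin; apply: eq_bigr => j _.
  by apply: stieltjes_itv; exact: gridpoint_le.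
(* A cell not contained in U is replaced by the empty interval at p. *)
pose l (j : 'I_(2 ^ k)) := if P j then gridpoint k j else p.
pose r (j : 'I_(2 ^ k)) := if P j then gridpoint k j.+1 else p.
rewrite nuE lee_fin big_mkcond/=.
rewrite (eq_bigr (fun j => `|F (r j) - F (l j)|)); last first.
  move=> j _; rewrite /r /l; case: ifP => _; last by rewrite subrr normr0.
  rewrite ger0_norm// subr_ge0 cumulative_is_nondecreasing//.
  exact: gridpoint_le.
apply/ltW/ac.
- move=> j; rewrite /l /r; case: ifP => _; last by rewrite lexx ltW.
  have /andP[-> _] := gridpoint_in (ltnW (ltn_ord j)).
  have /andP[_ ->] := gridpoint_in (ltn_ord j).
  by rewrite gridpoint_le.
- move=> i j _ _ [x]; rewrite /= !in_itv/= /l /r.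
  case: ifP => Pi [/andP[lx xr]]; last by move: (lt_trans lx xr); rewrite ltxx.
  case: ifP => Pj => /andP[lx' xr']; last by move: (lt_trans lx' xr'); rewrite ltxx.
  apply: tP => //; exists x; split; apply/cellP.
    by rewrite lx ltW.
  by rewrite lx' ltW.
- rewrite -lte_fin; apply: le_lt_trans Ud.
  rewrite (eq_bigr (fun j => if P j then gridpoint k j.+1 - gridpoint k j else 0)).
    rewrite -big_mkcond/= -muE; apply: le_mu => //.
      exact: measurable_grid_approx.
    exact: grid_approx_sub.
  by move=> j _; rewrite /l /r; case: ifP => // _; rewrite subrr.
Qed.

End grid_approximation.

(** A Lebesgue null set lies in open sets U of small measure.  The grid
    approximations of U have small total length, hence small Stieltjes measure,
    and so has their increasing union. *)
Lemma stieltjes_dominated (N : set R) : measurable N -> mu N = 0 ->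
  nu (N `&` `]p, q]%classic) = 0.
Proof.
move=> mN N0; have mD : measurable (`]p, q]%classic : set R) by exact: measurable_itv.
apply/eqP; rewrite eq_le measure_ge0 andbT; apply/lee_addgt0Pr => e e0.
rewrite add0e; have [d d0 ac] := acF e0.
have [|U [oU NU Ud]] := @lebesgue_regularity_outer R N d mN _ d0.
  by rewrite [ltLHS]N0.
have mU : measurable U by exact: open_measurable.
have Ud' : (mu U < d%:E)%E.
  apply: le_lt_trans Ud; rewrite -[X in (mu X <= _)%E](setDUK NU).
  apply: le_trans (measureU2 _ _ _) _ => //; first exact: measurableD.
  by rewrite [X in (X + _)%E]N0 add0e.
have mV : measurable (\bigcup_k grid_approx U k).
  by apply: bigcup_measurable => k _; exact: measurable_grid_approx.
apply: (@le_trans _ _ (nu (\bigcup_k grid_approx U k))).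
  apply: le_measure => //; try apply/mem_set.
  - exact: measurableI.
  - exact: mV.
  - move=> x [Nx Dx]; apply: grid_approx_cover => //; split => //; exact: NU.
have lim := @nondecreasing_cvg_mu _ _ _ nu (grid_approx U)
  (measurable_grid_approx U) mV (grid_approx_nondecreasing U).
apply: cvge_le lim; apply: nearW => k /=.
exact: grid_approx_stieltjes ac Ud' mU.
Qed.

(** The Radon-Nikodym density of the Stieltjes measure on the interval; by
    Lebesgue's differentiation theorem it is almost everywhere the derivative
    of its own primitive, which is F up to a constant. *)
Lemma stieltjes_density : exists g : R -> R,
  [/\ measurable_fun setT g, forall x, 0 <= g x,
      mu.-integrable setT (EFin \o g),
      forall x, p <= x <= q ->
        (\int[mu]_(t in `]p, x]) (g t)%:E = (F x - F p)%:E)%E &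
      {ae mu, forall x, p < x < q -> derivable F x 1 /\ derive1 F x = g x}].
Proof.
have mD : measurable (`]p, q]%classic : set R) by exact: measurable_itv.
have finD : (nu `]p, q]%classic < +oo)%E by rewrite stieltjes_itv ?ltry// ltW.
pose nuD : {finite_measure set (measurableTypeR R) -> \bar R} :=
  @mfrestr _ (measurableTypeR R) R _ nu mD finD.
have [|f [f0 ffin fint fE]] := @radon_nikodym_sigma_finite _ _ _ mu nuD.
  by apply/null_content_dominatesP => N mN N0; exact: stieltjes_dominated.
pose g x := fine (f x).
have fg x : f x = (g x)%:E by rewrite fineK.
have gE : EFin \o g = f by apply/funext => x /=; rewrite fg.
have gint x : p <= x <= q ->
    (\int[mu]_(t in `]p, x]) (g t)%:E = (F x - F p)%:E)%E.
  move=> /andP[px xq]; under eq_integral do rewrite -fg.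
  rewrite -fE; last exact: measurable_itv.
  rewrite -(stieltjes_itv px) /nuD/= /mfrestr /mrestr; congr (nu _).
  by apply: setIidl; apply: subset_itvl; rewrite bnd_simp.
have mg : measurable_fun setT g.
  by apply/measurable_EFinP; rewrite gE; exact: measurable_int fint.
exists g; split => //.
- by move=> x; rewrite fine_ge0.
- by rewrite gE.
have ig : mu.-integrable setT (EFin \o g) by rewrite gE.
have loc : locally_integrable setT g.
  by have := integrable_locally measurableT ig; rewrite patch_setT.
have igy y : mu.-integrable [set` Interval (BRight p) (BRight y)] (EFin \o g).
  by apply: integrableS ig => //; exact: measurable_itv.
have := FTC1 igy loc; apply: filterS; first exact: (ae_filter_ringOfSetsType mu).
move=> x + /andP[px xq] => /(_ px)[dG <-].
set G := (X in derivable X x 1) in dG *.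
have FG : \near x, F x = (cst (F p) + G) x.
  near=> y; have pyq : p <= y <= q.
    have py : p < y by near: y; exact: lt_nbhsr.
    have yq : y < q by near: y; exact: lt_nbhsl.
    by rewrite !ltW.
  have GE : G y = F y - F p := congr1 fine (gint y pyq).
  by change (F y = F p + G y); rewrite GE addrC subrK.
have GF : \near x, (cst (F p) + G) x = F x by apply: filterS FG => y ->.
split.
  by apply: near_eq_derivable GF _; apply: derivableD => //; exact: derivable_cst.
by rewrite !derive1E (near_eq_derive _ FG) deriveD// derive_cst add0r.
Unshelve. all: by end_near. Qed.

End absolutely_continuous_density.

(** * Derivative of a decreasing absolutely continuous function *)

Section decreasing_density.
Context {R : realType}.
Local Notation mu := (@lebesgue_measure R).

(** To obtain a Stieltjes measure on the line, - A is extended from [p,q] by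
    constants, that is, composed with the projection of the line onto [p,q]. *)
Lemma decreasing_density (A : R -> R) (p q : R) : p < q ->
  abs_continuous_on p q A ->
  (forall s t, p <= s -> s <= t -> t <= q -> A t <= A s) ->
  exists g : R -> R,
  [/\ measurable_fun setT g, forall x, 0 <= g x,
      (\int[mu]_(t in `]p, q]) (g t)%:E = (A p - A q)%:E)%E &
      {ae mu, forall x, p < x < q -> derive1 A x = - g x}].
Proof.
move=> pq acA decA; pose clamp x := Num.max p (Num.min x q).
have clampE x : p <= x <= q -> clamp x = x.
  by move=> /andP[px xq]; rewrite /clamp min_l// max_r.
have clamp_in x : p <= clamp x <= q.
  by rewrite /clamp le_max lexx/= ge_max (ltW pq)/= ge_min lexx orbT.
have clamp_le x y : x <= y -> clamp x <= clamp y.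
  move=> xy; rewrite /clamp ge_max le_max lexx/= le_max.
  by apply/orP; right; rewrite le_min !ge_min xy lexx orbT.
have clamp_lip x y : x <= y -> clamp y - clamp x <= y - x.
  move=> xy; rewrite /clamp; case: (leP y q) => yq; case: (leP x q) => xq;
    case: (leP p x) => px; case: (leP p y) => py; case: (leP p q) => pq'; lra.
pose F x := - A (clamp x).
have Fnd : {homo F : x y / x <= y}.
  move=> x y xy; rewrite /F lerN2; apply: decA; last 1 first.
  - by have /andP[] := clamp_in y.
  - by have /andP[] := clamp_in x.
  - exact: clamp_le.
have Fcont : continuous F.
  move=> x; apply/cvgrPdist_lt => e e0; have [d d0 ac] := acA e e0.
  have close y z : y <= z -> z - y < d -> `|F z - F y| < e.
    move=> yz zyd.
    have -> : `|F z - F y| = `|A (clamp z) - A (clamp y)|.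
      by rewrite /F opprK addrC distrC.
    have := ac 1%N (fun=> clamp y) (fun=> clamp z).
    rewrite !big_ord1; apply.
    - move=> _; have /andP[-> _] := clamp_in y; have /andP[_ ->] := clamp_in z.
      by rewrite clamp_le.
    - by move=> i j _ _ _; rewrite !ord1.
    - exact: le_lt_trans (clamp_lip _ _ yz) zyd.
  near=> y; have yd : `|x - y| < d.
    by near: y; exact: (@nbhsx_ballx _ _ x d d0).
  have [xy|yx] := leP x y.
    by rewrite distrC; apply: close => //; rewrite -(ger0_norm (x := y - x)) ?subr_ge0// distrC.
  by apply: close; rewrite ?ltW//; apply: le_lt_trans yd; exact: ler_norm.
have Frc := right_continuousW Fcont.
pose Fc : cumulative R R := HB.pack F (isCumulative.Build R _ R F Fnd Frc).
have acF : abs_continuous_on p q Fc.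
  move=> e e0; have [d d0 ac] := acA e e0; exists d => // n l r lr tlr lrd.
  rewrite (eq_bigr (fun i => `|A (r i) - A (l i)|)); first exact: ac.
  move=> i _; have [pl [lri rq]] := lr i.
  rewrite /= /F !clampE; last 2 first.
  - by rewrite pl (le_trans lri).
  - by rewrite rq (le_trans pl).
  by rewrite opprK addrC distrC.
have [g [mg g0 ig gE dF]] := stieltjes_density pq acF.
exists g; split => //.
  rewrite gE ?lexx ?ltW// /= /F !clampE ?lexx ?ltW//.
  by rewrite opprK addrC.
apply: filterS dF; first exact: (ae_filter_ringOfSetsType mu).
move=> x dF pxq; have [dFx <-] := dF pxq.
rewrite !derive1E -deriveN//; apply: near_eq_derive.
have /andP[px xq] := pxq.
near=> y; change (A y = - F y); rewrite /F opprK clampE//.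
have py : p < y by near: y; exact: lt_nbhsr.
have yq : y < q by near: y; exact: lt_nbhsl.
by rewrite !ltW.
Unshelve. all: by end_near. Qed.

End decreasing_density.

(** * K-spaces *)

Section K_spaces.
Context {R : realType} {E : topologicalLmodType R}.
Local Notation mu := (@lebesgue_measure R).
Local Notation I_oo := (`]0, +oo[%classic : set R).
Local Notation I_1 := (`]0, 1[%classic : set R).
Local Notation I_2 := (`[1, +oo[%classic : set R).

(** Monotone convergence for a non-measurable f, applied to its minorants. *)
Lemma integral_halfline_le (f : R -> \bar R) (C : \bar R) :
  (forall t, 1 <= t -> (0 <= f t)%E) ->
  (forall q : R, 1 < q -> (\int[mu]_(t in `[1%R, q]) f t <= C)%E) ->
  (\int[mu]_(t in I_2) f t <= C)%E.
Proof.
move=> f0 fC; apply: lower_integral_le.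
- exact: measurable_itv.
- by move=> t; rewrite mem_I_2; exact: f0.
move=> h mh h0 hf; pose D (n : nat) : set R := `[1, n.+2%:R]%classic.
have DE : I_2 = \bigcup_n D n.
  apply/seteqP; split => t.
    rewrite mem_I_2 => t1; exists (Num.bound t) => //.
    rewrite /D/= in_itv/= t1/=; apply: le_trans (ltW (archi_boundP _)) _.
      exact: le_trans t1.
    by rewrite ler_nat -addn2 leq_addr.
  by move=> [n _]; rewrite mem_I_2 /D/= in_itv/= => /andP[].
have mD n : measurable (D n) by exact: measurable_itv.
have ndD : nondecreasing_seq D.
  apply/nondecreasing_seqP => n; apply/subsetPset => t.
  rewrite /D/= !in_itv/= => /andP[-> /le_trans]; apply.
  by rewrite ler_nat.
have cvgh : (fun n => \int[mu]_(t in D n) (h t)%:E)%E @ \oo -->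
    (\int[mu]_(t in \bigcup_n D n) (h t)%:E)%E.
  apply: ge0_nondecreasing_set_cvg_integral => //.
  - by move=> n; apply/measurable_EFinP; exact: measurable_funTS.
  - by move=> n t _; rewrite lee_fin.
rewrite DE; apply: cvge_le cvgh; apply: nearW => n.
have q1 : (1 : R) < n.+2%:R by rewrite ltr1n.
apply: le_trans (fC _ q1); apply: lower_integral_mono => // t.
- by rewrite lee_fin.
- by rewrite /= in_itv/= => /andP[]; move=> /f0.
- by move=> Dt; apply: hf; rewrite DE; exists n.
Qed.

Variables Y0 Y1 : nspace R E.
Hypotheses (s0 : seminormed Y0) (s1 : seminormed Y1).
Let scap := seminormed_capY s0 s1.
Local Notation Y01 := (capY Y0 Y1).

Lemma car_sum_cap f : car (sumY Y0 Y01) f <-> car Y0 f.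
Proof.
split; first by move=> [p [p0 [p1 _] ->]]; exact: (carD s0).
move=> f0; exists (f, 0); split; rewrite /= ?addr0//.
exact: (car0 scap).
Qed.

Lemma Kfun_le_nrm f (t : R) : 0 <= t -> car Y0 f -> Kfun Y0 Y01 f t <= nrm Y0 f.
Proof.
move=> t0 f0; apply: le_trans (@Kfun_le _ _ _ _ s0 scap f t (f, 0) t0 _) _.
  by split; rewrite /= ?addr0//; exact: (car0 scap).
by rewrite /= -[Num.max _ _]/(nrm Y01 0) (nrm0 scap) mulr0 addr0.
Qed.

Lemma Kfun_ge_nrm f (t : R) : 0 <= t -> t <= 1 -> car Y0 f ->
  t * nrm Y0 f <= Kfun Y0 Y01 f t.
Proof.
move=> t0 t1 f0; apply: le_Kfun; first exact/car_sum_cap.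
move=> [f1 f2] [/= c1 [c2 c2'] ->].
apply: (@le_trans _ _ (t * nrm Y0 f1 + t * nrm Y0 f2)).
  by rewrite -mulrDr ler_wpM2l// (nrmD s0).
apply: lerD; first by rewrite ler_piMl// (nrm_ge0 s0).
by rewrite ler_wpM2l// le_max lexx.
Qed.

Variables (A B : R -> R).
Hypothesis A_ac : loc_abs_continuous A.
Hypothesis A_gt0 : forall t, 0 < t -> 0 < A t.
Hypothesis A_decr : forall s t, 0 < s -> s <= t -> A t <= A s.
Hypothesis A_half : A 1 < A 2^-1.
Hypothesis B_def : {ae mu, forall x : R, 0 < x -> B x = - (x * derive1 A x)}.

(** Off a null set, B(t)/t = - A'(t) = g(t). *)
Lemma K_integrand (p q : R) : 0 < p -> p < q -> exists (g : R -> R) (Z : set R),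
  [/\ measurable_fun setT g, forall x, 0 <= g x,
      (\int[mu]_(t in `]p, q]) (g t)%:E = (A p - A q)%:E)%E,
      measurable Z /\ mu Z = 0 &
      forall f t, car Y0 f -> p < t < q -> ~ Z t ->
        `|t^-1 * B t * Kfun Y0 Y01 f t| = g t * Kfun Y0 Y01 f t].
Proof.
move=> p0 pq; have acA : abs_continuous_on p q A by apply: A_ac => //; exact: ltW.
have decA s t : p <= s -> s <= t -> t <= q -> A t <= A s.
  by move=> ps st _; apply: A_decr => //; exact: lt_le_trans ps.
have [g [mg g0 gE dA]] := decreasing_density pq acA decA.
have [Z1 [mZ1 Z10 Z1P]] := dA; have [Z2 [mZ2 Z20 Z2P]] := B_def.
exists g, (Z1 `|` Z2); split => //.
  by split; [exact: measurableU|exact: null_set_setU].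
move=> f t f0 ptq nZ; have /andP[pt tq] := ptq; have t0 := lt_trans p0 pt.
have dAt : derive1 A t = - g t.
  by apply: contrapT => h; apply: nZ; left; apply: Z1P => /(_ ptq).
have Bt : B t = - (t * derive1 A t).
  by apply: contrapT => h; apply: nZ; right; apply: Z2P => /(_ t0).
rewrite Bt dAt [t * - _]mulrN opprK mulKf ?gt_eqF// ger0_norm// mulr_ge0//.
by apply: Kfun_ge0 => //; [exact: ltW|exact/car_sum_cap].
Qed.

Lemma Knorm_tail f : car Y0 f ->
  (\int[mu]_(t in I_2) (`|t^-1 * B t * Kfun Y0 Y01 f t|)%R%:E <=
   (nrm Y0 f * A 1)%:E)%E.
Proof.
move=> f0; apply: integral_halfline_le => [t _|q q1]; first by rewrite lee_fin.
have [g [Z [mg g0 gE [mZ Z0] KE]]] := K_integrand ltr01 q1.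
have n0 : 0 <= nrm Y0 f by exact: (nrm_ge0 s0).
pose Z' := Z `|` [set 1; q].
have mq (r : R) : measurable [set r] by exact: measurable_set1.
have m1q : measurable ([set 1; q] : set R) by exact: measurableU.
have mZ' : measurable Z' by exact: measurableU.
have mu1q : mu [set 1; q] = 0%E.
  by apply: countable_lebesgue_measure0; apply: finite_set_countable; exact: finite_set2.
have Z'0 : mu Z' = 0%E by exact: null_set_setU.
rewrite (lebesgue_integral_setD_null _ mZ' Z'0)//.
apply: (@le_trans _ _ (\int[mu]_(t in `]1%R, q]) ((nrm Y0 f)%:E * (g t)%:E))%E).
  apply: lower_integral_mono.
  - move=> t []; rewrite /= !in_itv/= => /andP[t1 ->] nZ; rewrite andbT lt_neqAle t1 andbT.
    by apply/eqP => h; apply: nZ; right; left.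
  - by move=> t _; rewrite lee_fin.
  - by move=> t _; rewrite -EFinM lee_fin mulr_ge0.
  - move=> t []; rewrite /= in_itv/= => /andP[t1 tq] nZ.
    have t1q : 1 < t < q.
      rewrite !lt_neqAle t1 tq !andbT; apply/andP; split; apply/eqP => h; apply: nZ.
        by right; left.
      by right; right.
    rewrite KE//; last by move=> Zt; apply: nZ; left.
    rewrite -EFinM lee_fin mulrC ler_wpM2r// Kfun_le_nrm//.
    exact: le_trans t1.
rewrite ge0_integralZl_EFin//.
- rewrite gE -EFinM lee_fin ler_wpM2l// gerBl ltW// A_gt0//.
  exact: lt_trans q1.
- by move=> t _; rewrite lee_fin.
- by apply/measurable_EFinP; exact: measurable_funTS.
Qed.

Let c0 := (A 2^-1 - A 1) / 2.

Lemma Knorm_head f : car Y0 f ->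
  ((c0 * nrm Y0 f)%:E <= Knorm Y0 Y01 I_1 B f)%E.
Proof.
move=> f0; have h0 : (0 : R) < 2^-1 by rewrite invr_gt0.
have h1 : (2^-1 : R) < 1 by rewrite invf_lt1// ltr1n.
have [g [Z [mg g0 gE [mZ Z0] KE]]] := K_integrand h0 h1.
have n0 : 0 <= nrm Y0 f by exact: (nrm_ge0 s0).
pose Z' := Z `|` [set 1].
have m1 : measurable ([set 1] : set R) by exact: measurable_set1.
have mZ' : measurable Z' by exact: measurableU.
have Z'0 : mu Z' = 0%E.
  by apply: null_set_setU => //; exact: (lebesgue_measure_set1 1).
have -> : (c0 * nrm Y0 f)%:E =
    (\int[mu]_(t in `]2^-1%R, 1%R]) ((nrm Y0 f / 2)%:E * (g t)%:E))%E.
  rewrite ge0_integralZl_EFin//.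
  - by rewrite gE -EFinM; congr EFin; rewrite /c0; ring.
  - by move=> t _; rewrite lee_fin.
  - by apply/measurable_EFinP; exact: measurable_funTS.
  - by rewrite divr_ge0.
rewrite (lebesgue_integral_setD_null _ mZ' Z'0); last 2 first.
- exact: measurable_itv.
- by move=> t _; rewrite -EFinM lee_fin mulr_ge0// divr_ge0.
have half t : (`]2^-1, 1]%classic `\` Z') t -> [/\ 2^-1 < t, t < 1 & ~ Z t].
  move=> []; rewrite /= in_itv/= => /andP[t2 t1] nZ; split => //.
    by rewrite lt_neqAle t1 andbT; apply/eqP => h; apply: nZ; right.
  by move=> Zt; apply: nZ; left.
apply: lower_integral_mono => [t /half[t2 t1 _]|t _|t _|t /half[t2 t1 nZ]].
- by rewrite mem_I_1 t1 andbT (lt_trans h0).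
- by rewrite -EFinM lee_fin mulr_ge0// divr_ge0.
- by rewrite lee_fin.
- rewrite KE// ?t2// -EFinM lee_fin mulrC ler_wpM2l//.
  apply: le_trans (Kfun_ge_nrm _ (ltW t1) f0); last by rewrite ltW// (lt_trans h0).
  by rewrite mulrC ler_wpM2r// ltW.
Qed.

Lemma Knorm_ge0 I f : (0 <= Knorm Y0 Y01 I B f)%E.
Proof. by apply: integral_ge0 => t _; rewrite lee_fin. Qed.

Lemma Knorm_sub_le f : (Knorm Y0 Y01 I_1 B f <= Knorm Y0 Y01 I_oo B f)%E.
Proof.
by apply: lower_integral_mono => //; exact: sub_I_1_oo.
Qed.

Lemma Knorm_truncate_le f : car Y0 f ->
  (Knorm Y0 Y01 I_oo B f <= (1 + A 1 / c0)%:E * Knorm Y0 Y01 I_1 B f)%E.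
Proof.
move=> f0; have c00 : 0 < c0 by rewrite divr_gt0// subr_gt0.
have A1 : 0 < A 1 by exact: A_gt0.
rewrite EFinD ge0_muleDl ?lee_fin//; last by rewrite divr_ge0 ?ltW.
rewrite mul1e /Knorm {1}/norm1 {1}I_ooE.
apply: le_trans (@lower_integral_setU _ _ R mu _ _ _ _ _ disj_I_1_2 _) _.
- exact: measurable_itv.
- exact: measurable_itv.
- by move=> t _; rewrite lee_fin.
apply: leeD => //; apply: le_trans (Knorm_tail f0) _.
rewrite -[norm1 _ _]/(Knorm Y0 Y01 I_1 B f).
have := Knorm_head f0; rewrite EFinM -lee_pdivlMl// => nK.
rewrite mulrC EFinM [X in (_ <= X * _)%E]EFinM -muleA.
by rewrite lee_pmul2l ?lte_fin.
Qed.

Lemma Kspace_truncate :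
  eq_nspace (Kspace Y0 Y01 I_oo B) (Kspace Y0 Y01 I_1 B).
Proof.
have c00 : 0 < c0 by rewrite divr_gt0// subr_gt0.
have A1 : 0 < A 1 by exact: A_gt0.
have C0 : 0 < 1 + A 1 / c0 by rewrite ltr_pwDl// divr_ge0 ?ltW.
split.
  apply/seteqP; split => f [cf ff]; split => //=.
    exact: le_lt_trans (Knorm_sub_le f) ff.
  have f0 : car Y0 f by exact/car_sum_cap.
  apply: le_lt_trans (Knorm_truncate_le f0) _.
  by rewrite lte_mul_pinfty// lee_fin ltW.
exists (1 + A 1 / c0)^-1, 1; split; rewrite ?invr_gt0// => f [cf ff] /=.
have f0 : car Y0 f by exact/car_sum_cap.
have oo_fin : Knorm Y0 Y01 I_oo B f \is a fin_num by rewrite ge0_fin_numE ?Knorm_ge0.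
have I1_fin : Knorm Y0 Y01 I_1 B f \is a fin_num.
  by rewrite ge0_fin_numE ?Knorm_ge0//; exact: le_lt_trans (Knorm_sub_le f) ff.
split.
  rewrite ler_pdivrMl// -lee_fin EFinM !fineK//.
  exact: Knorm_truncate_le.
by rewrite mul1r fine_le// Knorm_sub_le.
Qed.

End K_spaces.

(** * The weights *)

Lemma capY_idem (R : realType) (E : topologicalLmodType R) (Y0 Y1 : nspace R E) :
  capY Y0 (capY Y0 Y1) = capY Y0 Y1.
Proof.
rewrite /capY /=; congr NSpace; first by rewrite setIA setIid.
by apply/funext => f; rewrite maxA maxxx.
Qed.

Lemma strictly_decreasing_le (R : realType) (f : R -> R) (s t : R) :
  strictly_decreasing f -> 0 < s -> s <= t -> f t <= f s.
Proof.
move=> fd s0; rewrite le_eqVlt => /predU1P[->//|st].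
by apply: ltW; exact: fd.
Qed.

Lemma decreasing_ge_limit (R : realType) (f : R -> R) (l t : R) :
  strictly_decreasing f -> f x @[x --> +oo] --> l -> 0 < t -> l <= f t.
Proof.
move=> fd fl t0; apply/ler_addgt0Pr => e e0; rewrite -lerBlDr.
near (+oo : set_system R) => x.
apply: (@le_trans _ _ (f x)).
  apply: ltW; near: x; apply: (cvgr_gt _ fl).
  by rewrite ltrBlDr ltrDl.
apply: (strictly_decreasing_le fd t0).
by near: x; apply: nbhs_pinfty_ge; exact: num_real.
Unshelve. all: by end_near. Qed.

(** The function t b(t) is equivalent to a non-decreasing one. *)
Lemma slowly_varying_linear_lbound (R : realType) (b : R -> R) :
  slowly_varying b -> exists2 k : R, 0 < k & forall t, 1 <= t -> k <= b t * t.
Proof.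
move=> [b0 _ /(_ 1 ltr01)[[g [g0 gnd [[c c0 bg] [c' c'0 gb]]]] _]].
have t1 (t : R) : 0 < t -> t `^ 1 = t by move=> /ltW; exact: powRr1.
exists (b 1 / (c * c')); first by rewrite divr_gt0 ?mulr_gt0// b0.
move=> t t_ge1; have t0 : 0 < t by exact: lt_le_trans t_ge1.
rewrite ler_pdivrMr ?mulr_gt0//.
have := bg 1 ltr01; rewrite t1// mul1r => /le_trans; apply.
apply: (@le_trans _ _ (c * g t)); first by rewrite ler_pM2l// gnd.
have -> : b t * t * (c * c') = c * (c' * (t * b t)) by ring.
by rewrite ler_pM2l//; have := gb t t0; rewrite t1.
Qed.

(** The two decreasing pieces fit together at 1 because A is continuous there,
    which is absolute continuity for a single interval. *)
Lemma glued_decreasing (R : realType) (A f g : R -> R) :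
  (forall x, 0 < x -> x <= 1 -> A x = f x) -> (forall x, 1 < x -> A x = g x) ->
  loc_abs_continuous A -> strictly_decreasing f ->
  (forall s t, 1 < s -> s <= t -> g t <= g s) ->
  forall s t, 0 < s -> s <= t -> A t <= A s.
Proof.
move=> Af Ag acA fd gd.
have A1 t : 1 < t -> A t <= A 1.
  move=> t1; apply/ler_addgt0Pr => e e0.
  have [d d0 ac] := acA 1 t ltr01 (ltW t1) e e0.
  pose h := Num.min (d / 2) (t - 1).
  have h0 : 0 < h by rewrite lt_min divr_gt0//= subr_gt0.
  have hd : h < d by rewrite gt_min ltr_pdivrMr// ltr_pMr// ltr1n.
  have ht : 1 + h <= t by rewrite addrC -lerBrDr ge_min lexx orbT.
  have h1 : 1 < 1 + h by rewrite ltrDl.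
  have := ac 1%N (fun=> 1) (fun=> 1 + h); rewrite !big_ord1 => close.
  apply: (@le_trans _ _ (A (1 + h))); first by rewrite !Ag// gd.
  rewrite -lerBlDl; apply: le_trans (ler_norm _) (ltW (close _ _ _)).
  - by move=> _; rewrite lexx ltW.
  - by move=> i j _ _ _; rewrite !ord1.
  - by rewrite addrC addKr.
move=> s t s0 st; have t0 := lt_le_trans s0 st.
have [s1|s1] := leP s 1; last first.
  by rewrite !Ag ?gd// (lt_le_trans s1).
have [t1|t1] := leP t 1; first by rewrite !Af// strictly_decreasing_le.
apply: le_trans (A1 t t1) _; rewrite !Af//.
exact: strictly_decreasing_le.
Qed.

Unset Implicit Arguments.

Theorem mainTheorem14 (R : realType)
    (* the compatible couple (X0, X1) *)
    (E : topologicalLmodType R) (hE : hausdorff_space E)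
    (X0 X1 : completeNormedModType R)
    (i0 : {linear X0 -> E}) (i1 : {linear X1 -> E})
    (hi0 : continuous_embedding i0) (hi1 : continuous_embedding i1)
    (a : R -> R)
    (a_sv : slowly_varying a) (a_ac : loc_abs_continuous a)
    (a_decr : strictly_decreasing a)
    (a_0 : a x @[x --> 0^'+] --> +oo)
    (a_oo : exists2 l : R, 0 < l & a x @[x --> +oo] --> l)
    (alpha : R -> R)
    (alpha_sv : slowly_varying alpha) (alpha_ac : loc_abs_continuous alpha)
    (alpha_decr : strictly_decreasing alpha)
    (alpha_0 : alpha x @[x --> 0^'+] --> +oo)
    (alpha_oo : alpha x @[x --> +oo] --> (0 : R))
    (A : R -> R) (c : R) (c_gt0 : 0 < c)
    (A_le1 : forall x : R, 0 < x -> x <= 1 -> A x = a x)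
    (A_gt1 : forall x, 1 < x -> A x = c * alpha x)
    (A_sv : slowly_varying A) (A_ac : loc_abs_continuous A)
    (B : R -> R)
    (B_def : {ae @lebesgue_measure R, forall x : R, 0 < x -> B x = - (x * derive1 A x)}) :
  let Y0 := embedded i0 in
  let Y1 := embedded i1 in
  let I_oo : set R := `]0, +oo[%classic in
  let I_1 : set R := `]0, 1[%classic in
  [/\ eq_nspace (Jspace Y0 Y1 I_oo a) (Jspace Y0 Y1 I_1 a),
      eq_nspace (Jspace Y0 (capY Y0 Y1) I_oo A) (Jspace Y0 (capY Y0 Y1) I_1 A) &
      eq_nspace (Kspace Y0 (capY Y0 Y1) I_oo B) (Kspace Y0 (capY Y0 Y1) I_1 B)].
Proof.
move=> Y0 Y1 I_oo I_1.
have s0 : seminormed Y0 by exact: seminormed_embedded hi0.1.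
have s1 : seminormed Y1 by exact: seminormed_embedded hi1.1.
have scap := seminormed_capY s0 s1.
have capc : complete_nspace (capY Y0 Y1) by exact: complete_capY.
have h0 : (0 : R) < 2^-1 by rewrite invr_gt0.
have h1 : (2^-1 : R) < 1 by rewrite invf_lt1// ltr1n.
have [A_gt0 _ _] := A_sv.
have A_decr : forall s t, 0 < s -> s <= t -> A t <= A s.
  apply: (glued_decreasing A_le1 A_gt1 A_ac a_decr) => s t s1' st.
  rewrite ler_pM2l//; apply: strictly_decreasing_le => //.
  exact: lt_trans s1'.
split.
- have [l l0 al] := a_oo; have [a_gt0 _ _] := a_sv.
  apply: (@Jspace_truncate _ _ _ _ s0 s1 a (a 2^-1) l) => //.
  + by move=> t /a_gt0/ltW.
  + by move=> t t2 _; apply: strictly_decreasing_le => //; exact: ltW.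
  + move=> t f t1 [f0 f1]; have t0 := lt_le_trans ltr01 t1.
    apply: ler_pM; first exact: ltW.
    * exact: (nrm_ge0 scap).
    * exact: decreasing_ge_limit al t0.
    * rewrite /Jfun /= ge_max !le_max lexx/=; apply/orP; right.
      by rewrite ler_peMl// (nrm_ge0 s1).
- have [k k0 kA] := slowly_varying_linear_lbound A_sv.
  apply: (@Jspace_truncate _ _ _ _ s0 scap A (A 2^-1) k) => //.
  + by move=> t /A_gt0/ltW.
  + by move=> t t2 _; apply: A_decr => //; exact: ltW.
  + move=> t f t1; rewrite capY_idem => cf; have t0 := lt_le_trans ltr01 t1.
    apply: (@le_trans _ _ (A t * t * nrm (capY Y0 Y1) f)).
      by rewrite ler_wpM2r ?(nrm_ge0 scap)// kA.
    rewrite -mulrA ler_pM2l ?A_gt0// /Jfun le_max lexx orbT.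
    by [].
  + by rewrite capY_idem.
- apply: (Kspace_truncate s0 s1 A_ac A_gt0 A_decr _ B_def).
  by rewrite !A_le1// ?ltW//; exact: a_decr.
Qed.
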